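(* Let $\mathcal{A}$ be a finite alphabet and let $X\subseteq\mathcal{A}^{\mathbb{Z}}$ be a (nonempty) language stable subshift. Then $X$ has a characteristic measure that is a measure of maximal entropy: there is a $\sigma$-invariant Borel probability measure $\mu$ on $X$ such that $\psi_*\mu=\mu$ for every $\psi\in\mathrm{Aut}(X)$ and $h_\mu(\sigma)=h_{\mathrm{top}}(X)$.
   Context: A subshift is a closed subset $X\subseteq\mathcal{A}^{\mathbb{Z}}$ (product topology, $\mathcal{A}$ finite) that is invariant under the left shift $(\sigma x)_i=x_{i+1}$. $\mathrm{Aut}(X)$ is the group of homeomorphisms $\psi\colon X\to X$ with $\psi\sigma=\sigma\psi$. The language $\mathcal{L}(X)$ is the set of finite words over $\mathcal{A}$ that occur as a block of consecutive symbols in some element of $X$. A minimal forbidden word of $X$ is a finite word $w\notin\mathcal{L}(X)$ all of whose proper subwords (blocks of consecutive letters) lie in $\mathcal{L}(X)$; $\mathcal{M}_n(X)$ is the set of minimal forbidden words of length $n$. The upper Banach density of $S\subseteq\mathbb{N}$ is $d^*(S)=\limsup_{n\to\infty}\max_k |S\cap\{k,k+1,\dots,k+n-1\}|/n$. $X$ is language stable if $\{n\in\mathbb{N}\colon\mathcal{M}_n(X)=\emptyset\}$ has upper Banach density $1$. $h_\mu(\sigma)$ is measure-theoretic entropy and $h_{\mathrm{top}}(X)$ is the topological entropy of $(X,\sigma)$. *)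

(* Defs.v *)
From HB Require Import structures.
From mathcomp Require Import all_boot all_order all_algebra finmap.
From mathcomp Require Import all_classical all_reals all_analysis.

Set Implicit Arguments.
Unset Strict Implicit.
Unset Printing Implicit Defensive.

Import Order.TTheory GRing.Theory Num.Theory.
Import numFieldNormedType.Exports.

Local Open Scope classical_set_scope.
Local Open Scope ring_scope.

Definition config (A : finType) : Type := {ptws int -> discrete_topology A}.

Definition shift (A : finType) (x : config A) : config A := fun i => x (i + 1).

(* Nonemptiness is part of the structure because measurable types are pointed
   in the library. *)
Record subshift (A : finType) := Subshift {
  subshift_set :> set (config A);
  subshift_nonempty : subshift_set !=set0;
  subshift_closed : closed subshift_set;
  subshift_invariant : @shift A @` subshift_set = subshift_set }.

Section Points.
Variables (A : finType) (X : subshift A).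

(* The phase space X as a type, with the subspace topology. *)
Definition points : Type := set_type X.

HB.instance Definition _ := Topological.on points.

Lemma points_inhabited : exists _ : points, True.
Proof.
by have [x Xx] := subshift_nonempty X; exists (exist _ x (mem_set Xx)).
Qed.

HB.instance Definition _ := isPointed.Build points (projT1 (cid points_inhabited)).

Definition borel := g_sigma_algebraType (@open points).

Lemma shift_in (x : points) : shift (\val x) \in subshift_set X.
Proof.
rewrite -[X in _ \in X]subshift_invariant; apply/mem_set.
by exists (\val x) => //; apply: set_mem; exact: (valP x).
Qed.

Definition points_shift (x : points) : points :=
  exist (fun y : config A => y \in subshift_set X) _ (shift_in x).

Definition automorphism (psi : points -> points) : Prop :=
  [/\ continuous psi,
      exists phi : points -> points,
        [/\ continuous phi, cancel psi phi & cancel phi psi] &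
      forall x, psi (points_shift x) = points_shift (psi x)].

End Points.

Section Language.
Variables (A : finType) (X : subshift A).

Definition language : set (seq A) :=
  [set w | exists (x : config A) (i : int),
     subshift_set X x /\ w = [seq (x (i + j%:Z) : A) | j <- iota 0 (size w)]].

Definition minimal_forbidden (n : nat) : set (seq A) :=
  [set w | [/\ size w = n, ~ language w &
     forall u : seq A, infix u w -> u != w -> language u]].

End Language.

Definition upper_banach_density (R : realType) (S : set nat) : \bar R :=
  limn_esup (fun n : nat => ereal_sup (range (fun k : nat =>
    (#|[set i : 'I_n | `[< S (k + i)%N >]]%SET|%:R / n%:R : R)%:E))).

Definition language_stable (R : realType) (A : finType) (X : subshift A) : Prop :=
  upper_banach_density R [set n | minimal_forbidden X n = set0] = 1%E.

Section MeasureEntropy.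
Context d (T : measurableType d) (R : realType).
Variables (mu : probability T R) (f : T -> T).

Definition preserves : Prop :=
  forall B : set T, measurable B -> pushforward mu f B = mu B.

(* A finite partition of T is given by its labelling map q : T -> I, whose
   fibres are the (possibly empty) atoms.  Since ln 0 = 0 in the library, null
   atoms contribute 0. *)
Definition partition_entropy (I : finType) (q : T -> I) : R :=
  - \sum_(i : I) fine (mu (q @^-1` [set i])) * ln (fine (mu (q @^-1` [set i]))).

(* The join of q, f^-1 q, ..., f^-(n-1) q. *)
Definition itinerary (I : finType) (q : T -> I) (n : nat) (x : T) :
  {ffun 'I_n -> I} := [ffun i : 'I_n => q (iter i f x)].

Definition entropy_of_partition (I : finType) (q : T -> I) : R :=
  limn (fun n : nat => partition_entropy (itinerary q n) / n%:R).

Definition measure_entropy : \bar R :=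
  ereal_sup [set h | exists (k : nat) (q : T -> 'I_k),
    (forall i, measurable (q @^-1` [set i])) /\
    h = (entropy_of_partition q)%:E].

End MeasureEntropy.

(* Topological entropy in the sense of Adler, Konheim and McAndrew. *)
Section TopologicalEntropy.
Variables (R : realType) (T : topologicalType) (f : T -> T).

Definition is_cover (U : set (set T)) : Prop := \bigcup_(V in U) V = setT.

Definition open_cover (U : set (set T)) : Prop := U `<=` open /\ is_cover U.

(* The least cardinality of a finite subcover, +oo if there is none. *)
Definition subcover_number (U : set (set T)) : \bar R :=
  ereal_inf [set (#|` F|%:R : R)%:E | F in
    [set F : {fset set T} | [set` F] `<=` U /\ is_cover [set` F]]].

(* The join of U, f^-1 U, ..., f^-(n-1) U. *)
Definition cover_join (U : set (set T)) (n : nat) : set (set T) :=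
  [set \bigcap_(i : 'I_n) (iter i f @^-1` V i) | V in
    [set V : 'I_n -> set T | forall i, U (V i)]].

Definition entropy_of_cover (U : set (set T)) : \bar R :=
  limn (fun n : nat => lne (subcover_number (cover_join U n)) * (n%:R^-1)%:E)%E.

Definition topological_entropy : \bar R :=
  ereal_sup [set entropy_of_cover U | U in open_cover].

End TopologicalEntropy.

(* Main.v *)
(* Language stability gives, for every k, some n >= k such that no minimal
   forbidden word has length in [n+1, n+k]; a sequence all of whose words of
   length n lie in the language of X then has all its words of length n+k there.
   Consider the N-periodic sequences of this kind. An automorphism of X and its
   inverse are block maps whose windows are smaller than k, so they permute these
   finitely many sequences. Decomposing a walk at its last visit to a vertex
   shows that closed walks grow as fast as all walks, so for suitable N there are
   at least exp (N (h - 1/k)) such sequences, h being the topological entropy. A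
   limit along an ultrafilter of the uniform measures on these sets is invariant
   under the shift and under Aut(X). Subadditivity of block entropies carries the
   lower bound h to the limit. Conversely, approximating a partition by a clopen
   one and applying Gibbs' inequality to words of X perturbed letter by letter
   shows that no invariant measure has entropy above h. *)
From HB Require Import structures.
Require Import Defs.
From mathcomp Require Import all_boot all_order all_algebra finmap.
From mathcomp Require Import all_classical all_reals all_analysis.
From mathcomp Require Import ring lra zify.

Set Implicit Arguments.
Unset Strict Implicit.
Unset Printing Implicit Defensive.

Import Order.TTheory GRing.Theory Num.Theory.
Import numFieldNormedType.Exports.

Local Open Scope classical_set_scope.
Local Open Scope ring_scope.

(** * Windows and compactness *)

(** The periodic sequences need not lie in [X]; they lie only in the shift of finite type cut out by
    the words of one length. An automorphism therefore has to be replaced by its block rule, which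
    makes sense wherever the windows look like [X]. The obstacle is a loss of margin: a rule of
    radius [r] shrinks by [r] the radius on which the image is known to look like [X], so it would
    not map the set of loops into itself. The run of lengths without minimal forbidden words gives
    this margin back. The return to [X] chooses nearby points arbitrarily, which breaks
    equivariance, but a cylinder of small window cannot notice the choice. Letting [k] grow serves
    all automorphisms with one sequence of measures, since each has a finite radius and is handled
    by all but finitely many [k]. The shift of finite type may be reducible and have no closed walks
    at some lengths, hence the freedom to choose the vertex and the period. *)

Definition agree (A : finType) (m : nat) (x y : int -> A) : Prop :=
  forall i : int, (absz i <= m)%N -> x i = y i.

Section Agree.
Variable A : finType.
Implicit Types x y z : int -> A.

Lemma agree_refl m x : agree m x x. Proof. by []. Qed.

Lemma agree_sym m x y : agree m x y -> agree m y x.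
Proof. by move=> xy i im; rewrite xy. Qed.

Lemma agree_trans m x y z : agree m x y -> agree m y z -> agree m x z.
Proof. by move=> xy yz i im; rewrite xy ?yz. Qed.

Lemma agree_le m n x y : (m <= n)%N -> agree n x y -> agree m x y.
Proof. by move=> mn xy i im; rewrite xy // (leq_trans im). Qed.

End Agree.

Section Topology.
Variables (A : finType) (X : subshift A).
Implicit Types x y z : points X.

Definition crd x : int -> A := \val x.

Lemma crd_inj : injective crd.
Proof. by move=> x y xy; apply: val_inj. Qed.

Lemma nbhs_agree (x : config A) m : nbhs x [set y : config A | agree m x y].
Proof.
have coord (i : int) : nbhs x [set y : config A | y i = x i].
  have cont := @proj_continuous int (fun=> discrete_topology A) i.
  exact: (cont x _ (discrete_set1 (x i))).
have := @filter_forall _ _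
  (fun (j : 'I_(m + m).+1) (y : config A) => y (j%:Z - m%:Z) = x (j%:Z - m%:Z))
  (nbhs x) _ (fun j => coord _).
move=> /(_ _)/filterS; apply => y yx i im.
have jm : (absz (i + m%:Z)%R < (m + m).+1)%N by lia.
have /= := yx (Ordinal jm).
have -> : (absz (i + m%:Z)%R)%:Z - m%:Z = i by lia.
by [].
Qed.

(** The agreement classes of [x] are a filter base converging to [x] in every coordinate, hence in
    the product topology. *)
Lemma open_agree (V : set (config A)) (x : config A) :
  open V -> V x -> exists m, forall y : config A, agree m x y -> V y.
Proof.
move=> oV Vx.
pose F := filter_from setT (fun m : nat => [set y : config A | agree m x y]).
have FF : Filter F.
  apply: filter_from_filter; first by exists 0%N.
  move=> i j _ _; exists (maxn i j) => // y xy; split.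
    by apply: agree_le xy; rewrite leq_maxl.
  by apply: agree_le xy; rewrite leq_maxr.
have Fx : F --> x.
  apply/cvg_sup => i B; rewrite nbhsE => -[_ [[W oW <-] Wx] WB].
  by exists (absz i) => // y /= xy; apply: WB; rewrite /= -xy.
have [|m _ mV] := Fx V; last by exists m => y /mV.
exact: open_nbhs_nbhs.
Qed.

Lemma open_points_agree (V : set (points X)) x :
  open V -> V x -> exists m, forall y, agree m (crd x) (crd y) -> V y.
Proof.
move=> [W oW <-] /= Wx; have [m mW] := open_agree oW Wx.
by exists m => y /mW.
Qed.

Definition windowed (m : nat) (C : set (points X)) : Prop :=
  forall x y, agree m (crd x) (crd y) -> C x -> C y.

(** By compactness these are exactly the clopen subsets of [X]. *)
Definition cylindrical (C : set (points X)) : Prop := exists m, windowed m C.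

Lemma cylindrical_open C : cylindrical C -> open C.
Proof.
case=> m mC; rewrite openE => x Cx; rewrite /interior.
have cval := @initial_continuous (points X) (config A) (fun y => \val y).
apply: (@filterS _ _ (nbhs_filter x) _ _ _ (cval x _ (nbhs_agree (crd x) m))) => y /= xy.
exact: mC xy Cx.
Qed.

(* Compactness of X in the form in which it is used throughout. *)
Lemma uniform_window (Q : nat -> points X -> Prop) :
  (forall m n x, (m <= n)%N -> Q m x -> Q n x) ->
  (forall y, exists m, forall x, agree m (crd y) (crd x) -> Q m x) ->
  exists m, forall x, Q m x.
Proof.
move=> Qle Qloc; apply: contrapT => /forallNP noQ.
have {noQ} /choice [x noQ] : forall m, exists x, ~ Q m x.
  by move=> m; apply/existsNP; exact: noQ.
(* The counterexamples [x m] have a coordinatewise limit [y] along an ultrafilter, since each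
   coordinate takes finitely many values. As [X] is closed it contains [y], and the local bound at
   [y] refutes [x k] for some large [k]. *)
have [U [UU leU]] := ultraFilterLemma eventually_filter.
have ylim (i : int) : exists a : A, U [set m | crd (x m) i = a].
  apply: contrapT => /forallNP noa.
  have : U [set m | forall a, crd (x m) i <> a].
    apply: (@filter_forall _ _ (fun a m => crd (x m) i <> a) U) => a.
    have [Ua|//] := in_ultra_setVsetC [set m | crd (x m) i = a] UU.
    by have := noa a Ua.
  by move=> /filter_ex[m /(_ (crd (x m) i))].
have [y yP] := choice ylim.
have Uy m : U [set k | agree m (y : config A) (crd (x k))].
  have := @filter_forall _ _
    (fun (j : 'I_(m + m).+1) k => crd (x k) (j%:Z - m%:Z) = y (j%:Z - m%:Z))
    U _ (fun j => yP _).
  move=> /(_ _)/filterS; apply => k xy i im.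
  have jm : (absz (i + m%:Z)%R < (m + m).+1)%N by lia.
  have /= := xy (Ordinal jm).
  by have -> : (absz (i + m%:Z)%R)%:Z - m%:Z = i by lia.
have Xy : subshift_set X y.
  apply: subshift_closed => V; rewrite nbhsE => -[W [oW Wy] WV].
  have [m mW] := open_agree oW Wy.
  have [k /= yk] := filter_ex (Uy m).
  by exists (\val (x k)); split; [exact/set_mem/(valP (x k))|exact/WV/mW].
have [m mQ] := Qloc (exist _ y (mem_set Xy)).
have Um : U [set k | (m <= k)%N] by apply: leU; exists m.
have [k [/= mk yk]] := filter_ex (filterI Um (Uy m)).
by apply: (noQ k); apply: Qle mk _; exact: mQ.
Qed.

Lemma lebesgue_window (U : set (set (points X))) : open_cover U ->
  exists m, forall x, exists2 V, U V & forall y, agree m (crd x) (crd y) -> V y.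
Proof.
move=> [oU cU].
apply: (@uniform_window (fun m x => exists2 V, U V & forall y, agree m (crd x) (crd y) -> V y)).
  by move=> m n x mn [V UV mV]; exists V => // y /(agree_le mn)/mV.
move=> y; have : (\bigcup_(V in U) V) y by rewrite cU.
move=> [V UV Vy]; have [m mV] := open_points_agree (oU _ UV) Vy.
exists m => x yx; exists V => // z xz; apply: mV; exact: agree_trans yx xz.
Qed.

(** The compactness half of the Curtis-Hedlund-Lyndon theorem. Coordinate 0 suffices, because
    commutation with the shift carries the window to every other coordinate. *)
Lemma continuous_window (psi : points X -> points X) : continuous psi ->
  exists m, forall x y, agree m (crd x) (crd y) ->
    crd (psi x) 0 = crd (psi y) 0.
Proof.
move=> cpsi.
have [] := @uniform_window (fun m x => forall y, agree m (crd x) (crd y) ->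
    crd (psi x) 0 = crd (psi y) 0).
- by move=> m n x mn mx y /(agree_le mn)/mx.
- move=> y.
  have oy : open (psi @^-1` [set z | crd (psi y) 0 = crd z 0]).
    apply: open_comp; first by move=> z _; exact: cpsi.
    apply: cylindrical_open; exists 0%N => z t zt /= ->.
    exact: zt.
  have [m my] := open_points_agree oy erefl.
  exists m => x yx z xz; rewrite -(my x yx); apply: my; exact: agree_trans yx xz.
- by move=> m mP; exists m => x y; exact: mP.
Qed.

Lemma iter_points_shift n x i :
  crd (iter n (@points_shift A X) x) i = crd x (i + n%:Z).
Proof.
elim: n x i => [|n IH] x i /=; first by rewrite addr0.
have -> : i + n.+1%:Z = i + 1 + n%:Z by lia.
exact: IH.
Qed.

Lemma shift_preimage x : exists y : points X, points_shift y = x.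
Proof.
have : (@Defs.shift A @` subshift_set X) (crd x).
  by rewrite subshift_invariant; exact/set_mem/(valP x).
move=> [y Xy yx].
by exists (exist _ y (mem_set Xy)); apply: val_inj.
Qed.

Lemma translate (x : points X) (k : int) :
  exists y : points X, forall i, crd y i = crd x (i + k).
Proof.
have neg n : exists y : points X, forall i, crd y i = crd x (i - n%:Z).
  elim: n => [|n [y yx]]; first by exists x => i; rewrite subr0.
  have [z zy] := shift_preimage y; exists z => i.
  have -> : crd z i = crd y (i - 1) by rewrite -zy /crd /= /Defs.shift subrK.
    rewrite yx; congr (_ _); lia.
case: k => n.
  by exists (iter n (@points_shift A X) x) => i; rewrite iter_points_shift.
by have [y yx] := neg n.+1; exists y => i; rewrite yx NegzE.
Qed.

End Topology.

(** * Words, language and gaps *)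

Section Words.
Variable A : finType.
Implicit Types (x y : int -> A) (i : int).

Definition word x i n : seq A := [seq x (i + j%:Z) | j <- iota 0 n].

Lemma size_word x i n : size (word x i n) = n.
Proof. by rewrite size_map size_iota. Qed.

Lemma nth_word a x i n j : (j < n)%N -> nth a (word x i n) j = x (i + j%:Z).
Proof. by move=> jn; rewrite (nth_map 0%N) ?size_iota// nth_iota. Qed.

Lemma eq_word x y i j n :
  (forall k, (k < n)%N -> x (i + k%:Z) = y (j + k%:Z)) -> word x i n = word y j n.
Proof.
move=> xy; apply/eq_in_map => k; rewrite mem_iota => /andP[_ kn]; exact: xy.
Qed.

Lemma word_inj x y i j n : word x i n = word y j n ->
  forall k, (k < n)%N -> x (i + k%:Z) = y (j + k%:Z).
Proof.
by move=> xy k kn; rewrite -(nth_word (x i) x i kn) xy nth_word.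
Qed.

Lemma word_cat x i m n : word x i (m + n) = word x i m ++ word x (i + m%:Z) n.
Proof.
rewrite /word iotaD map_cat add0n; congr (_ ++ _).
rewrite -{1}[m]addn0 iotaDl -map_comp; apply: eq_map => k /=.
by congr (x _); lia.
Qed.

Lemma word_cons x i n : word x i n.+1 = x i :: word x (i + 1) n.
Proof. by rewrite -add1n word_cat /word /= addr0. Qed.

Lemma word_rcons x i n : word x i n.+1 = rcons (word x i n) (x (i + n%:Z)).
Proof. by rewrite -addn1 word_cat cats1 /word /= addr0. Qed.

Lemma word_tupleP x i n : size (word x i n) == n.
Proof. by rewrite size_word. Qed.

Definition tword x i n : n.-tuple A := Tuple (word_tupleP x i n).

End Words.

Section Language.
Variables (A : finType) (X : subshift A).
Implicit Types (x y : points X) (w u : seq A).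

Lemma language_word x i n : language X (word (crd x) i n).
Proof.
exists (\val x), i; split; first exact/set_mem/(valP x).
by rewrite size_word.
Qed.

Lemma languageP w k : language X w -> exists x, w = word (crd x) k (size w).
Proof.
move=> [x [i [Xx ew]]].
have [y yx] := translate (exist _ x (mem_set Xx) : points X) (i - k).
exists y; rewrite {1}ew; apply: eq_word => j _.
by rewrite yx /crd /=; congr (x _); lia.
Qed.

Lemma language_infix u w : infix u w -> language X w -> language X u.
Proof.
move=> /infixP[a [b ->]] /(languageP 0)[x].
rewrite !size_cat !word_cat => /eqP.
rewrite eqseq_cat ?size_word// => /andP[_].
rewrite eqseq_cat ?size_word// => /andP[/eqP -> _].
exact: language_word.
Qed.

Definition Lang n : {set n.-tuple A} := [set w : n.-tuple A | `[< language X w >]].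

Lemma in_Lang n (w : n.-tuple A) : reflect (language X w) (w \in Lang n).
Proof. by rewrite inE; exact: asboolP. Qed.

Lemma tword_Lang x i n : tword (crd x) i n \in Lang n.
Proof. by apply/in_Lang; exact: language_word. Qed.

Lemma card_Lang_gt0 n : (0 < #|Lang n|)%N.
Proof. by apply/card_gt0P; exists (tword (crd (point : points X)) 0 n); exact: tword_Lang. Qed.

Lemma card_LangD m n : (#|Lang (m + n)| <= #|Lang m| * #|Lang n|)%N.
Proof.
pose cat_words (p : m.-tuple A * n.-tuple A) := cat_tuple p.1 p.2.
rewrite -cardsX; apply: leq_trans (leq_imset_card cat_words _).
apply/subset_leq_card/fintype.subsetP => w /in_Lang /(languageP 0)[x wx].
apply/imsetP; exists (tword (crd x) 0 m, tword (crd x) m%:Z n).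
  by rewrite inE /= !tword_Lang.
by apply: val_inj; rewrite /= wx size_tuple word_cat add0r.
Qed.

End Language.

(** * Language stability and approximating shifts of finite type *)

Section Gaps.
Variables (A : finType) (X : subshift A).

(** Membership in the shift of finite type that approximates [X] from outside at order [n]. *)
Definition locally_in (n : nat) (y : int -> A) : Prop :=
  forall i, language X (word y i n).

Lemma proper_infix (u w : seq A) (a : A) : infix u (a :: w) -> u != a :: w ->
  infix u w \/ infix u (belast a w).
Proof.
rewrite infix_consl => /orP[/prefixP[t]|]; last by left.
case/lastP: t => [|t c]; first by rewrite cats0 => ->; rewrite eqxx.
rewrite lastI -rcons_cat => /eqP; rewrite eqseq_rcons => /andP[/eqP -> _] _.
by right; apply/infixP; exists [::], t.
Qed.

(* A word outside the language whose two maximal proper subwords are in the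
   language is minimal forbidden, so no obstruction appears across the gap. *)
Lemma locally_in_gap n k y :
  (forall l, (n < l <= n + k)%N -> minimal_forbidden X l = set0) ->
  locally_in n y -> forall l, (n <= l <= n + k)%N -> locally_in l y.
Proof.
move=> gap yn; elim=> [|l IH] lk i.
  by have <- : n = 0%N by [lia]; exact: yn.
have [<-|nl] := eqVneq n l.+1; first exact: yn.
have {}IH : locally_in l y by apply: IH; lia.
apply: contrapT => yl.
have : minimal_forbidden X l.+1 (word y i l.+1).
  split=> //; first exact: size_word.
  move=> u uw nuw.
  move: uw nuw; rewrite {1 2}word_cons => /proper_infix/[apply] -[] uw.
    exact: language_infix uw (IH _).
  apply: language_infix (uw) _.
  have -> : belast (y i) (word y (i + 1) l) = word y i l; last exact: IH.
  have := word_rcons y i l; rewrite word_cons lastI => /eqP.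
  by rewrite eqseq_rcons => /andP[/eqP].
by rewrite gap//; lia.
Qed.

(** If every aligned block of length [K.*2] missed a point of [S], one miss per block would keep the
    density in long windows below 1. A full block is twice as long as the run, so that the run can
    start beyond [k]. *)
Lemma dense_run (R : realType) (S : set nat) : upper_banach_density R S = 1%E ->
  forall k, exists2 n, (k <= n)%N & forall l, (n < l <= n + k)%N -> S l.
Proof.
move=> dS k; pose K := k.+1.
have [n [s [nK Sn]]] : exists n s, (K.*2 <= n)%N /\
    (n < (#|[set i : 'I_n | `[< S (s + i)%N >]]%SET| + n %/ K.*2))%N.
  pose dens n s : R := #|[set i : 'I_n | `[< S (s + i)%N >]]%SET|%:R / n%:R.
  (* The margin is half of the miss rate [1/(2K)]; the other half absorbs the floor in [n %/ K.*2],
     which is at least [n / (4K)] once [K.*2 <= n]. *)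
  have : ((1 - (4 * K%:R)^-1 : R)%:E < ereal_sup
     ((fun n => ereal_sup (range (fun s => (dens n s)%:E))) @` [set n | (K.*2 <= n)%N]))%E.
    apply: (@lt_le_trans _ _ 1%E).
      by rewrite lte_fin ltrBlDr ltrDl invr_gt0 mulr_gt0.
    rewrite -dS; apply: ereal_inf_lbound.
    by exists [set n | (K.*2 <= n)%N] => //; exists K.*2.
  move=> /ereal_sup_gt[_ [n /= nK <-]] /ereal_sup_gt[_ [s _ <-]].
  rewrite lte_fin /dens => Sn; exists n, s; split => //.
  set c := #|_| in Sn *.
  have n0 : 0 < n%:R :> R by rewrite ltr0n; lia.
  have q2 : (n < (n %/ K.*2 + n %/ K.*2) * K.*2)%N.
    have := divn_eq n K.*2; have := @ltn_pmod n K.*2 isT.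
    have : (0 < n %/ K.*2)%N by rewrite divn_gt0.
    move: (n %/ _)%N (n %% _)%N => q r q0 rK en; nia.
  have q3 : n%:R / (4 * K%:R) <= (n %/ K.*2)%:R :> R.
    rewrite ler_pdivrMr ?mulr_gt0// -!natrM ler_nat.
    move: q2; rewrite -muln2; move: (n %/ _)%N => q; lia.
  move: Sn; rewrite ltr_pdivlMr// mulrBl mul1r ltrBlDr => Sn.
  rewrite -(ltr_nat R) natrD; apply: lt_le_trans Sn _.
  by rewrite lerD2l mulrC.
have [[j jq Sj]|nobl] := pselect (exists2 j, (j < n %/ K.*2)%N &
    forall l, (j * K.*2 <= l < j.+1 * K.*2)%N -> S (s + l)%N).
  exists (s + j * K.*2 + k)%N; first by lia.
  move=> l ll; have -> : l = (s + (l - s))%N by lia.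
  by apply: Sj; rewrite /K; nia.
have miss (j : 'I_(n %/ K.*2)) : exists i : 'I_n, ~ S (s + i)%N /\ (i %/ K.*2)%N = j.
  apply: contrapT => nomiss; apply: nobl; exists j => // l lj.
  apply: contrapT => nS.
  have ln : (l < n)%N.
    have : (j.+1 * K.*2 <= n)%N by rewrite -leq_divRL//; exact: ltn_ord.
    by case/andP: lj => _; exact: leq_trans.
  apply: nomiss; exists (Ordinal ln); split => //=.
  apply/eqP; rewrite eqn_leq leq_divRL// -ltnS ltn_divLR//; lia.
have [f fP] := choice miss.
have finj : injective f.
  by move=> i j fij; apply: val_inj; rewrite /= -(fP i).2 -(fP j).2 fij.
have : (n %/ K.*2 <= #|~: [set i : 'I_n | `[< S (s + i)%N >]]%SET|)%N.
  rewrite -[leqLHS]card_ord -(card_imset _ finj); apply/subset_leq_card.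
  apply/fintype.subsetP => _ /imsetP[j _ ->]; rewrite !inE; apply/asboolP.
  exact: (fP j).1.
have := cardsC [set i : 'I_n | `[< S (s + i)%N >]]%SET.
by rewrite card_ord; lia.
Qed.

End Gaps.

(** * Measures on cylinders *)

Section Cylinders.
Variables (A : finType) (X : subshift A).
Implicit Types (C D : set (points X)).

Lemma cylindrical0 : cylindrical (set0 : set (points X)).
Proof. by exists 0%N. Qed.

Lemma cylindricalC C : cylindrical C -> cylindrical (~` C).
Proof.
by case=> m mC; exists m => x y /agree_sym yx Cx /(mC _ _ yx).
Qed.

Lemma cylindricalT : cylindrical (setT : set (points X)).
Proof. by exists 0%N. Qed.

Lemma cylindricalU C D : cylindrical C -> cylindrical D -> cylindrical (C `|` D).
Proof.
case=> m mC [n nD]; exists (maxn m n) => x y xy [Cx|Dx].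
  by left; apply: mC Cx; apply: agree_le xy; rewrite leq_maxl.
by right; apply: nD Dx; apply: agree_le xy; rewrite leq_maxr.
Qed.

Lemma cylindricalI C D : cylindrical C -> cylindrical D -> cylindrical (C `&` D).
Proof.
move=> cC cD; rewrite -[C `&` D]setCK setCI.
by apply/cylindricalC/cylindricalU; exact: cylindricalC.
Qed.

Lemma open_bigcup_cylindrical (V : set (points X)) : open V ->
  exists2 C : nat -> set (points X), (forall n, cylindrical (C n)) & V = \bigcup_n C n.
Proof.
move=> oV; exists (fun n => [set x | forall y, agree n (crd x) (crd y) -> V y]).
  move=> n; exists n => x y xy Vx z yz; apply: Vx; exact: agree_trans xy yz.
apply/seteqP; split=> [x Vx|x [n _]]; last by apply; exact: agree_refl.
by have [n Vn] := open_points_agree oV Vx; exists n.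
Qed.

(** A copy of the phase space that carries the algebra of cylindrical sets, the domain of the
    premeasure; [borel X] carries the generated sigma-algebra. *)
Definition cylspace : Type := points X.
HB.instance Definition _ := Pointed.on cylspace.

Fact cylspace_display : measure_display. Proof. exact: (default_measure_display). Qed.

HB.instance Definition _ := @isAlgebraOfSets.Build cylspace_display cylspace
  (@cylindrical A X) cylindrical0 cylindricalU cylindricalC.

Lemma borel_cylindricalE :
  (measurable : set (set (borel X))) = <<s @cylindrical A X >>.
Proof.
apply/seteqP; split; apply: smallest_sub.
- exact: smallest_sigma_algebra.
- move=> V /open_bigcup_cylindrical[C cC ->].
  apply: (@bigcupT_measurable _ (g_sigma_algebraType (@cylindrical A X))) => n.
  exact: sub_sigma_algebra.
- exact: smallest_sigma_algebra.
- by move=> C /cylindrical_open; exact: sub_sigma_algebra.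
Qed.

Lemma measurable_cylindrical C : cylindrical C -> measurable (C : set (borel X)).
Proof. by rewrite borel_cylindricalE => cC; exact: sub_sigma_algebra. Qed.

End Cylinders.

(** * From cylindrical sets to Borel sets *)

Section Extension.
Variables (R : realType) (A : finType) (X : subshift A).

(** Countable additivity on the algebra comes from compactness: if a disjoint union of cylindrical
    sets is cylindrical, finitely many of them already exhaust it. Carathéodory's extension does the
    rest. *)
Lemma probability_extension (p : set (points X) -> R) :
  (forall C, 0 <= p C) -> p setT = 1 ->
  (forall C D, cylindrical C -> cylindrical D -> C `&` D = set0 ->
    p (C `|` D) = p C + p D) ->
  exists mu : probability (borel X) R, forall C, cylindrical C -> mu C = (p C)%:E.
Proof.
move=> p_ge0 pT pU.
pose m (C : set (cylspace X)) : \bar R := (p C)%:E.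
have p0 : p set0 = 0.
  have := pU _ _ (cylindrical0 X) (cylindrical0 X); rewrite setU0 setI0 => /(_ erefl).
  by move=> /eqP; rewrite -subr_eq subrr => /eqP.
have m0 : m set0 = 0%E by rewrite /m p0.
have m_ge0 C : (0 <= m C)%E by rewrite lee_fin.
have p_sum (F : nat -> set (points X)) : (forall i, cylindrical (F i)) ->
    trivIset setT F -> forall n, cylindrical (\bigcup_(i < n) F i) /\
      p (\bigcup_(i < n) F i) = \sum_(0 <= i < n) p (F i).
  move=> cF tF; elim=> [|n [cn IH]].
    by rewrite bigcup_mkord big_ord0 big_geq//; split; [exact: cylindrical0|].
  rewrite bigcup_mkord big_ord_recr/= big_nat_recr//= -IH -!bigcup_mkord.
  split; first exact: cylindricalU.
  rewrite pU//; apply/seteqP; split=> // x [[i /= ilt Fi] Fn].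
  by have := tF i n I I (ex_intro _ x (conj Fi Fn)); lia.
have m_add : semi_sigma_additive m.
  move=> F mF tF mU.
  have [] := @uniform_window A X (fun n x => (\bigcup_i F i) x -> exists2 i, (i <= n)%N & F i x).
  - move=> i j x ij Fi /Fi[k ki Fk]; exists k => //; exact: leq_trans ij.
  - move=> y; have [[i _ Fi]|nF] := pselect ((\bigcup_i F i) y).
      have [n nF] := mF i; exists (maxn i n) => x yx _; exists i; first exact: leq_maxl.
      by apply: nF Fi; apply: agree_le yx; exact: leq_maxr.
    (* A point outside the union has a whole window outside it, because the union is itself
       cylindrical. *)
    have [n nU] := mU; exists n => x yx Fx; exfalso; apply: nF.
    by apply: nU Fx; exact: agree_sym.
  move=> n nF.
  have bigE k : (n < k)%N -> \bigcup_i F i = \bigcup_(i < k) F i.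
    move=> nk; apply/seteqP; split => x; last by move=> [i _ Fi]; exists i.
    by move=> /nF[i ilt Fi]; exists i => //=; exact: leq_ltn_trans nk.
  apply: cvg_near_cst; exists n.+1 => // k /= nk.
  by rewrite /m sumEFin (bigE k)// (p_sum F mF tF k).2.
pose mm : {measure set (cylspace X) -> \bar R} :=
  HB.pack m (isMeasure.Build _ _ _ m m0 m_ge0 m_add).
pose mu (B : set (borel X)) : \bar R := measure_extension mm B.
have muE C : cylindrical C -> mu C = (p C)%:E.
  by move=> cC; rewrite /mu /measure_extension measurable_mu_extE.
have mu0 : mu set0 = 0%E by rewrite muE ?p0//; exact: cylindrical0.
have mu_ge0 B : (0 <= mu B)%E by exact: mu_ext_ge0.
have mu_add : semi_sigma_additive mu.
  move=> F mF tF mU; apply: (@measure_semi_sigma_additive _ _ _ (measure_extension mm)) => //.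
    by move=> i; have := mF i; rewrite borel_cylindricalE.
  by move: mU; rewrite borel_cylindricalE.
have muT : mu setT = 1%E by rewrite muE ?pT//; exact: cylindricalT.
pose mum : {measure set (borel X) -> \bar R} :=
  HB.pack mu (isMeasure.Build _ _ _ mu mu0 mu_ge0 mu_add).
pose P : probability (borel X) R :=
  HB.pack (Measure.sort mum) (Measure_isProbability.Build _ _ _ (Measure.sort mum) muT).
by exists P.
Qed.

Variable mu : probability (borel X) R.

(** Cylindrical sets are a pi-system generating the Borel sets, so they determine a probability. *)
Lemma preserves_cylindrical (psi : points X -> points X) : continuous psi ->
  (forall C, cylindrical C -> mu (psi @^-1` C) = mu C) -> preserves mu psi.
Proof.
move=> cpsi muC B mB.
have mpsi : measurable_fun setT (psi : borel X -> borel X).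
  apply: (@measurability _ _ (borel X) (borel X) _ _ (@open (points X))) => // _ [V oV <-].
  rewrite setTI; apply: sub_sigma_algebra; apply: open_comp => // x _; exact: cpsi.
pose psi' : {mfun borel X >-> borel X} :=
  HB.pack (psi : borel X -> borel X) (isMeasurableFun.Build _ _ _ _ _ mpsi).
apply: (@measure_unique _ _ (borel X) (@cylindrical A X) (fun=> setT)
   (borel_cylindricalE X) _ _ _ (pushforward mu psi') mu) => //.
- by move=> C D; exact: cylindricalI.
- by move=> _; exact: cylindricalT.
- by rewrite bigcup_const.
- by move=> _; rewrite /= /pushforward preimage_setT probability_setT ltry.
Qed.

Lemma le_mu2 (B C D : set (borel X)) : measurable B -> measurable C -> measurable D ->
  B `<=` C `|` D -> (mu B <= mu C + mu D)%E.
Proof.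
move=> mB mC mD BCD; apply: le_trans (measureU2 mu mC mD).
by apply: le_measure; rewrite ?inE//; exact: measurableU.
Qed.

(** The sets that can be approximated form a sigma-algebra containing the open sets. For a countable
    union, the tails [H n] decrease to the empty set, so continuity from above reduces to a finite
    union. *)
Lemma cylindrical_approx (B : set (borel X)) (e : R) : measurable B -> 0 < e ->
  exists2 C : set (borel X), cylindrical C & (mu (B `+` C) <= e%:E)%E.
Proof.
pose S := [set B : set (borel X) | measurable B /\ forall e : R, 0 < e ->
  exists2 C : set (borel X), cylindrical C & (mu (B `+` C) <= e%:E)%E].
have cS C : cylindrical C -> S C.
  move=> cC; split=> [|d d0]; first exact: measurable_cylindrical.
  exists C => //; have -> : C `+` C = set0 by apply/seteqP; split=> // x; rewrite /setY /=; tauto.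
  by rewrite measure0 lee_fin ltW.
have mY B' C : measurable B' -> cylindrical C -> measurable ((B' : set (borel X)) `+` C).
  by move=> mB' cC; move/measurable_cylindrical: cC => mC; apply: measurableU; exact: measurableD.
have S0 : S set0 by apply: cS; exact: cylindrical0.
have SC B' : S B' -> S (~` B').
  move=> [mB' aB']; split=> [|d /aB'[C cC Cd]]; first exact: measurableC.
  exists (~` C); first exact: cylindricalC.
  suff -> : ~` B' `+` ~` C = B' `+` C by [].
  apply/seteqP; split => x; rewrite /setY /=; have := EM (B' x); have := EM (C x); tauto.
have SU B1 B2 : S B1 -> S B2 -> S (B1 `|` B2).
  move=> [mB1 aB1] [mB2 aB2]; split=> [|d d0]; first exact: measurableU.
  have d2 : 0 < d / 2 by rewrite divr_gt0.
  have [C1 cC1 C1d] := aB1 _ d2; have [C2 cC2 C2d] := aB2 _ d2.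
  exists (C1 `|` C2); first exact: cylindricalU.
  rewrite (splitr d) EFinD; apply: le_trans (leeD C1d C2d); apply: le_mu2.
  - by apply: mY (measurableU _ _ mB1 mB2) (cylindricalU cC1 cC2).
  - exact: mY.
  - exact: mY.
  - by move=> x; rewrite /setY /=; tauto.
have SS (F : nat -> set (borel X)) : (forall i, S (F i)) -> S (\bigcup_i F i).
  move=> SF; have mU : measurable (\bigcup_i F i).
    by apply: bigcupT_measurable => i; exact: (SF i).1.
  split=> // d d0; pose G n := \bigcup_(i < n) F i.
  have SG n : S (G n).
    elim: n => [|n IH]; first by rewrite /G bigcup_mkord big_ord0.
    by rewrite /G bigcup_mkord big_ord_recr/= -bigcup_mkord; exact: SU.
  pose H n := \bigcup_i F i `\` G n.
  have mH n : measurable (H n) by apply: measurableD => //; exact: (SG n).1.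
  have H0 : \bigcap_n H n = set0.
    apply/seteqP; split=> // x Hx; have [[i _ Fi] _] := Hx 0%N I.
    by have [_] := Hx i.+1 I; apply; exists i => /=.
  have cvH : mu \o H @ \oo --> mu (\bigcap_n H n).
    apply: nonincreasing_cvg_mu => //.
    - by apply: le_lt_trans (probability_le1 _ _) (ltry _).
    - by rewrite H0.
    - move=> i j ij; apply/subsetPset => x [Fx nG]; split=> // -[k ki Fk]; apply: nG.
      by exists k => //=; exact: leq_trans ij.
  have d2 : 0 < d / 2 by rewrite divr_gt0.
  have [n Hn] : exists n, (mu (H n) <= (d / 2)%:E)%E.
    rewrite H0 measure0 in cvH.
    have /(_ _ _)/filter_ex[n /= Hn] := cvgr_lt 0 (fine_cvg cvH) _ d2.
    exists n; rewrite -[leLHS]fineK ?lee_fin ?(ltW Hn)//.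
    by rewrite fin_num_measure.
  have [C cC Cd] := (SG n).2 _ d2; exists C => //.
  rewrite (splitr d) EFinD; apply: le_trans (leeD Hn Cd); apply: le_mu2.
  - exact: mY.
  - exact: mH.
  - exact: mY (SG n).1 cC.
  - have GF : G n `<=` \bigcup_i F i by move=> x [i _ Fi]; exists i.
    move=> x; have := GF x; have := EM (G n x).
    by rewrite /setY /H /=; tauto.
have : measurable `<=` S.
  apply: smallest_sub; first split=> //.
    by move=> B' SB'; rewrite setTD; exact: SC.
  by move=> V /open_bigcup_cylindrical[C cC ->]; apply: SS => n; exact: cS.
by move=> /[apply] -[_]; apply.
Qed.

End Extension.

(** * Entropy of stationary processes *)

Section RealLemmas.
Variable R : realType.

(** Fekete's lemma. The limit is the infimum of the quotients, which is why it bounds each of them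
    from below. *)
Lemma fekete (u : nat -> R) : (forall n, 0 <= u n) ->
  (forall m n, u (m + n)%N <= u m + u n) ->
  exists2 l : R, (fun n => u n / n%:R) @ \oo --> l &
    forall n, (0 < n)%N -> l <= u n / n%:R.
Proof.
move=> u0 uD.
pose S := [set u n / n%:R | n in [set n : nat | (0 < n)%N]].
have lbS : lbound S 0 by move=> _ [n n0 <-]; rewrite divr_ge0.
have S0 : S !=set0 by exists (u 1%N / 1); exists 1%N.
have hS : has_inf S by split => //; exists 0.
have infS n : (0 < n)%N -> inf S <= u n / n%:R.
  by move=> n0; apply: ge_inf; [exists 0|exists n].
exists (inf S) => //; apply/cvgrPdist_le => e e0.
have e2 : 0 < e / 2 by rewrite divr_gt0.
have [_ [m /= m0 <-] mS] := inf_adherent e2 hS.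
have uq q r : u (q * m + r)%N <= q%:R * u m + u r.
  elim: q => [|q IH]; first by rewrite mul0r add0r.
  rewrite mulSn -addnA; apply: le_trans (uD _ _) _.
  by move: IH; rewrite -natr1 mulrDl mul1r; lra.
(* One bound for all remainders modulo [m]; divided by [n] it vanishes. *)
pose B := \sum_(r < m) u r.
have uB r : (r < m)%N -> u r <= B.
  by move=> rm; rewrite /B (bigD1 (Ordinal rm))//= lerDl sumr_ge0.
have mR : 0 < m%:R :> R by rewrite ltr0n.
near=> n.
have n0 : (0 < n)%N by near: n; exists 1%N.
have nR : 0 < n%:R :> R by rewrite ltr0n.
rewrite ler0_norm ?subr_le0 ?infS// opprB lerBlDl.
have nB : B / n%:R <= e / 2.
  rewrite ler_pdivrMr// -ler_pdivrMl//; near: n; exact: nbhs_infty_ger.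
have -> : inf S + e = inf S + e / 2 + e / 2 by rewrite -addrA -splitr.
apply: le_trans (lerD (ltW mS) nB).
rewrite -(ler_pM2r nR) mulrDl !divfK ?gt_eqF//.
rewrite {1}(divn_eq n m); apply: le_trans (uq _ _) _.
apply: lerD; last by rewrite uB// ltn_pmod.
rewrite mulrAC ler_pdivlMr// mulrAC -natrM (mulrC (u m)) ler_wpM2r//.
by rewrite ler_nat leq_trunc_div.
Unshelve. all: by end_near. Qed.

Lemma ln_le_sub1 (x : R) : 0 < x -> ln x <= x - 1.
Proof. by move=> x0; rewrite -{1}(subrKC 1 x) le_ln1Dx// ltrBrDl subrr. Qed.

(** This is [ln t <= t - 1] at [t = q i / p i], weighted by [p i] and summed. Allowing [q] to have
    total mass below that of [p] permits subprobabilities as reference. *)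
Lemma gibbs_inequality (I : finType) (p q : I -> R) : (forall i, 0 <= p i) ->
  (forall i, 0 <= q i) -> (forall i, 0 < p i -> 0 < q i) ->
  \sum_i q i <= \sum_i p i ->
  - \sum_i p i * ln (p i) <= - \sum_i p i * ln (q i).
Proof.
move=> p0 q0 pq qp; rewrite lerN2 -subr_ge0 -sumrB.
apply: (@le_trans _ _ (\sum_i (p i - q i))); first by rewrite sumrB subr_ge0.
apply: ler_sum => i _; have := p0 i; rewrite le_eqVlt => /predU1P[<-|pi].
  by rewrite !mul0r subrr sub0r oppr_le0.
have qi := pq i pi.
have := ln_le_sub1 (divr_gt0 qi pi); rewrite ln_div ?posrE// => /(ler_wpM2l (ltW pi)).
have -> : p i * (q i / p i - 1) = q i - p i by field; rewrite gt_eqF.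
by rewrite mulrBr; lra.
Qed.

(** This is [ln t <= t - 1] at [t = 1 / sqrt x]. It supplies continuity of [x * ln x] at 0, where
    [ln] itself is not continuous. *)
Lemma xlnx_le_sqrt (x : R) : 0 <= x <= 1 -> `|x * ln x| <= 2 * Num.sqrt x.
Proof.
move=> /andP[]; rewrite le_eqVlt => /predU1P[<-|x0] x1.
  by rewrite mul0r normr0 sqrtr0 mulr0.
have lnx : ln x <= 0 by rewrite ln_le0.
have s0 : 0 < Num.sqrt x by rewrite sqrtr_gt0.
set s := Num.sqrt x in s0 *.
have xs : x = s * s by rewrite -expr2 sqr_sqrtr// ltW.
have : ln s^-1 <= s^-1 - 1 by rewrite ln_le_sub1// invr_gt0.
rewrite lnV ?posrE// ler0_norm; last by rewrite mulr_ge0_le0// ltW.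
have -> : ln x = ln s + ln s by rewrite xs lnM ?posrE.
move=> /(ler_wpM2l (ltW x0)); rewrite xs mulrBr -(mulrA s s s^-1) mulfV ?gt_eqF//.
rewrite !mulr1 mulrN; have : 0 <= s * s by rewrite mulr_ge0// ltW.
lra.
Qed.

Lemma cvg_xlnx (T : Type) (F : set_system T) (f : T -> R) (l : R) :
  ProperFilter F -> (forall t, 0 <= f t) -> f @ F --> l ->
  (fun t => f t * ln (f t)) @ F --> l * ln l.
Proof.
move=> PF f0 fl.
have l0 : 0 <= l.
  rewrite -(cvg_lim (@norm_hausdorff _ _) fl); apply: limr_ge; first exact: cvgP fl.
  exact: nearW.
move: l0; rewrite le_eqVlt => /predU1P[l0|l0]; last first.
  apply: cvgM => //; apply: continuous_cvg => //; exact: continuous_ln.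
rewrite -l0 mul0r in fl *; apply/norm_cvg0P.
have sl : (fun t => 2 * Num.sqrt (f t)) @ F --> (0 : R).
  rewrite -[X in _ --> X](mulr0 2); apply: cvgM; first exact: cvg_cst.
  rewrite -sqrtr0; apply: continuous_cvg => //; exact: sqrt_continuous.
apply: (@squeeze_cvgr _ _ _ _ (fun=> 0) (fun t => 2 * Num.sqrt (f t))) => //; last exact: cvg_cst.
near=> t; rewrite normr_ge0 xlnx_le_sqrt// f0/= ltW//.
near: t; exact: (cvgr_lt 0).
Unshelve. all: by end_near. Qed.

End RealLemmas.

Section Tuples.
Variables (R : realType) (I : finType).
Implicit Types (F : seq I -> R).

Lemma sum_tuple0 F : \sum_(w : 0.-tuple I) F w = F [::].
Proof.
rewrite (eq_bigr (fun=> F [::])) => [|w _]; last by rewrite (tuple0 w).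
by rewrite sumr_const card_tuple expn0.
Qed.

Lemma sum_tupleS F n :
  \sum_(w : n.+1.-tuple I) F w = \sum_a \sum_(w : n.-tuple I) F (a :: w).
Proof.
rewrite pair_big /= (reindex (fun p : I * n.-tuple I => [tuple of p.1 :: p.2])) //=.
exists (fun w => (thead w, [tuple of behead w])) => [[a w] _|w _] /=.
  by congr (_, _); apply: val_inj.
by rewrite -tuple_eta.
Qed.

Lemma sum_tupleD F m n : \sum_(w : (m + n).-tuple I) F w =
  \sum_(u : m.-tuple I) \sum_(v : n.-tuple I) F (u ++ v).
Proof.
elim: m F => [|m IH] F; first by rewrite (sum_tuple0 (fun u => \sum_(v : n.-tuple I) F (u ++ v))).
rewrite (sum_tupleS (fun u => \sum_(v : n.-tuple I) F (u ++ v))).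
rewrite (sum_tupleS F (m + n)); apply: eq_bigr => a _.
exact: (IH (fun w => F (a :: w))).
Qed.

End Tuples.

Section StationaryProcess.
Variables (R : realType) (I : finType).

(** The word probabilities of a stationary process: summing over a last letter is consistency of the
    marginals, summing over a first letter is invariance under the shift. A function on lists
    handles all block lengths at once. *)
Definition stationary (p : seq I -> R) : Prop :=
  [/\ forall w, 0 <= p w, p [::] = 1, forall w, \sum_a p (a :: w) = p w &
      forall w, \sum_a p (rcons w a) = p w].

Definition block_entropy (p : seq I -> R) (n : nat) : R :=
  - \sum_(w : n.-tuple I) p w * ln (p w).

Variable p : seq I -> R.
Hypothesis sp : stationary p.

Let p_ge0 w : 0 <= p w. Proof. by case: sp. Qed.

Lemma sum_suffix n u : \sum_(v : n.-tuple I) p (u ++ v) = p u.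
Proof.
have [_ _ _ pr] := sp.
elim: n u => [|n IH] u; first by rewrite (sum_tuple0 (fun v => p (u ++ v))) cats0.
rewrite (sum_tupleS (fun v => p (u ++ v))) -[RHS]pr; apply: eq_bigr => a _.
by rewrite -IH; apply: eq_bigr => v _; rewrite cat_rcons.
Qed.

Lemma sum_prefix n v : \sum_(u : n.-tuple I) p (u ++ v) = p v.
Proof.
have [_ _ pl _] := sp.
elim: n v => [|n IH] v; first by rewrite (sum_tuple0 (fun u => p (u ++ v))).
rewrite (sum_tupleS (fun u => p (u ++ v))) exchange_big -[RHS]IH.
by apply: eq_bigr => u _; rewrite -[RHS]pl.
Qed.

Lemma sum_blocks n : \sum_(w : n.-tuple I) p w = 1.
Proof. by have [_ <- _ _] := sp; rewrite -(sum_suffix n). Qed.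

Lemma le_prefix u v : p (u ++ v) <= p u.
Proof.
by rewrite -(sum_suffix (size v) u) (bigD1 (in_tuple v))//= lerDl sumr_ge0.
Qed.

Lemma le_suffix u v : p (u ++ v) <= p v.
Proof.
by rewrite -(sum_prefix (size u) v) (bigD1 (in_tuple u))//= lerDl sumr_ge0.
Qed.

Lemma block_entropy_ge0 n : 0 <= block_entropy p n.
Proof.
rewrite /block_entropy oppr_ge0; apply: sumr_le0 => w _.
rewrite mulr_ge0_le0// ln_le0//; have [_ <- _ _] := sp.
exact: (le_prefix [::]).
Qed.

(** Gibbs' inequality against the product of the marginals on the first [m] and the last [n]
    letters, that is, nonnegativity of mutual information. *)
Lemma block_entropyD m n :
  block_entropy p (m + n) <= block_entropy p m + block_entropy p n.
Proof.
have gibbs := @gibbs_inequality R ((m + n).-tuple I) (fun w => p w)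
  (fun w => p (take m w) * p (drop m w)).
apply: le_trans (gibbs _ _ _ _) _ => //.
- by move=> w; rewrite mulr_ge0.
- move=> w pw; rewrite mulr_gt0// (lt_le_trans pw)// -{1}(cat_take_drop m w).
    exact: le_prefix.
  exact: le_suffix.
- rewrite sum_blocks (sum_tupleD (fun w => p (take m w) * p (drop m w))).
  under eq_bigr => u _ do under eq_bigr => v _ do
    rewrite take_size_cat ?size_tuple// drop_size_cat ?size_tuple//.
  under eq_bigr => u _ do rewrite -mulr_sumr sum_blocks mulr1.
  by rewrite sum_blocks.
rewrite (sum_tupleD (fun w => p w * ln (p (take m w) * p (drop m w)))).
rewrite /block_entropy -opprD lerN2.
have -> : \sum_(w : m.-tuple I) p w * ln (p w) =
    \sum_(u : m.-tuple I) \sum_(v : n.-tuple I) p (u ++ v) * ln (p u).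
  by apply: eq_bigr => u _; rewrite -mulr_suml sum_suffix.
have -> : \sum_(w : n.-tuple I) p w * ln (p w) =
    \sum_(u : m.-tuple I) \sum_(v : n.-tuple I) p (u ++ v) * ln (p v).
  by rewrite exchange_big; apply: eq_bigr => v _; rewrite -mulr_suml sum_prefix.
rewrite -big_split; apply: ler_sum => u _; rewrite -big_split; apply: ler_sum => v _.
rewrite /= take_size_cat ?size_tuple// drop_size_cat ?size_tuple// -mulrDr.
have := p_ge0 (u ++ v); rewrite le_eqVlt => /predU1P[<-|puv]; first by rewrite !mul0r.
by rewrite lnM// posrE; apply: lt_le_trans puv _; [exact: le_prefix|exact: le_suffix].
Qed.

Lemma block_entropy_mul q m : block_entropy p (q * m) <= q%:R * block_entropy p m.
Proof.
elim: q => [|q IH].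
  rewrite mul0n mul0r /block_entropy (sum_tuple0 (fun w => p w * ln (p w))).
  by have [_ -> _ _] := sp; rewrite ln1 mulr0 oppr0.
rewrite mulSn; apply: le_trans (block_entropyD _ _) _.
by rewrite -natr1 mulrDl mul1r addrC lerD2r.
Qed.

End StationaryProcess.

(** * Growth of closed walks *)

Section ClosedWalks.
Variables (R : realType) (V : finType) (e : rel V).
Implicit Types (S : {set V}) (x y v : V).

Fixpoint walks S n x : R :=
  if x \in S then if n is m.+1 then \sum_(y | e x y) walks S m y else 1 else 0.

Fixpoint walks_to v n x : R :=
  if n is m.+1 then \sum_(y | e x y) walks_to v m y else (x == v)%:R.

Lemma walks_ge0 S n x : 0 <= walks S n x.
Proof.
elim: n x => [|n IH] x /=; case: ifP => // _.
by apply: sumr_ge0 => y _; exact: IH.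
Qed.

Lemma walks_to_ge0 v n x : 0 <= walks_to v n x.
Proof. by elim: n x => [|n IH] x //=; apply: sumr_ge0 => y _; exact: IH. Qed.

(* Counts the walks of length n from v that stay in S and never return to v. *)
Definition excursions S v n : R :=
  if n is m.+1 then \sum_(y | e v y) walks (S :\ v) m y else 1.

(* Decomposition of a walk at its last visit to v. *)
Lemma walks_last_visit S v n x :
  walks S n x <= walks (S :\ v) n x +
    \sum_(a < n.+1) walks_to v a x * excursions S v (n - a).
Proof.
have exc_ge0 m : 0 <= excursions S v m.
  by case: m => //= m; apply: sumr_ge0 => y _; exact: walks_ge0.
have sum_ge0 m y : 0 <= \sum_(a < m.+1) walks_to v a y * excursions S v (m - a).
  by apply: sumr_ge0 => a _; rewrite mulr_ge0// walks_to_ge0.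
elim: n x => [|n IH] x.
  rewrite big_ord_recl big_ord0 /= !in_setD1.
  by case: (x \in S); case: eqVneq => _ /=; lra.
have [xS|xS] := boolP (x \in S); last first.
  rewrite [walks S _ _]/= (negPf xS) addr_ge0 ?walks_ge0//.
apply: (@le_trans _ _ (\sum_(y | e x y) walks (S :\ v) n y +
    \sum_(y | e x y) \sum_(a < n.+1) walks_to v a y * excursions S v (n - a))).
  by rewrite /= xS -big_split; apply: ler_sum => y _; exact: IH.
rewrite big_ord_recl addrA; apply: lerD; last first.
  rewrite exchange_big; apply: ler_sum => a _.
  by rewrite -mulr_suml subSS.
rewrite subn0 [walks _ n.+1 x]/= [walks_to _ _ _]/= in_setD1 xS andbT.
by case: eqVneq => [->|_] /=; lra.
Qed.

(** Induction on [#|S|]: cutting a walk at the last visit to its start [x] leaves a closed walk at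
    [x] and an excursion in [S :\ x]. There are [n.+1] possible cuts, so each removed vertex costs a
    factor [K * n.+1%:R]. In [K], the term [#|V|%:R / lambda] pays for the first step of an
    excursion and the summand 1 for the empty excursion. *)
Lemma walks_le (C lambda : R) : 1 <= C -> 0 < lambda ->
  (forall a v, walks_to v a v <= C * lambda ^+ a) ->
  let K := C * (#|V|%:R / lambda + 1) in
  forall S n x, walks S n x <= (K * n.+1%:R) ^+ #|S| * lambda ^+ n.
Proof.
move=> C1 l0 closed K S.
have C0 : 0 <= C by apply: le_trans C1.
have D1 : 1 <= #|V|%:R / lambda + 1 by rewrite lerDr divr_ge0// ltW.
have K1 : 1 <= K by rewrite -[1]mulr1 ler_pM.
have K0 : 0 <= K by apply: le_trans K1.
move En : #|S| => s; elim: s S En => [|s IH] S En n x.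
  have -> : walks S n x = 0.
    by move/eqP: En; rewrite cards_eq0 => /eqP ->; case: n => [|n] /=; rewrite inE.
  by rewrite expr0 mul1r exprn_ge0// ltW.
have [xS|xS] := boolP (x \in S); last first.
  have -> : walks S n x = 0 by case: n => [|n] /=; rewrite (negPf xS).
  by apply: mulr_ge0; apply: exprn_ge0; [exact: mulr_ge0|exact: ltW].
have sS : #|S :\ x| = s by have := cardsD1 x S; rewrite xS En; lia.
have Kn m : (m <= n)%N -> (K * m.+1%:R) ^+ s <= (K * n.+1%:R) ^+ s.
  move=> mn; apply: lerXn2r; first by rewrite nnegrE; exact: mulr_ge0.
    by rewrite nnegrE; exact: mulr_ge0.
  by apply: ler_wpM2l => //; rewrite ler_nat.
have excE m : (m <= n)%N -> excursions S x m <=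
    (#|V|%:R / lambda + 1) * (K * n.+1%:R) ^+ s * lambda ^+ m.
  case: m => [_|m mn] /=.
    rewrite expr0 mulr1 -[leLHS]mulr1 ler_pM// exprn_ege1//.
    by rewrite -[leLHS]mulr1 ler_pM// ler1n.
  apply: (@le_trans _ _ (\sum_(y : V) (K * n.+1%:R) ^+ s * lambda ^+ m)).
    rewrite [leRHS](bigID (e x))/= -[leLHS]addr0 lerD//; last first.
      by apply: sumr_ge0 => y _; apply: mulr_ge0; apply: exprn_ge0; [exact: mulr_ge0|exact: ltW].
    apply: ler_sum => y _; apply: le_trans (IH _ sS _ _) _.
    by apply: ler_wpM2r; [rewrite exprn_ge0// ltW|apply: Kn; rewrite ltnW].
  rewrite sumr_const -[leLHS]mulr_natl exprS.
  have -> : (#|V|%:R / lambda + 1) * (K * n.+1%:R) ^+ s * (lambda * lambda ^+ m) =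
    #|V|%:R * ((K * n.+1%:R) ^+ s * lambda ^+ m) + (K * n.+1%:R) ^+ s * (lambda * lambda ^+ m).
    by field; rewrite gt_eqF.
  rewrite lerDl; apply: mulr_ge0; first by rewrite exprn_ge0// mulr_ge0.
  by rewrite mulr_ge0 ?exprn_ge0// ltW.
apply: le_trans (walks_last_visit S x n x) _.
have -> : walks (S :\ x) n x = 0 by case: n {Kn excE} => [|n] /=; rewrite !inE eqxx.
rewrite add0r.
apply: (@le_trans _ _ (\sum_(a < n.+1) (K * (K * n.+1%:R) ^+ s * lambda ^+ n))).
  apply: ler_sum => a _.
  have an : (a <= n)%N by rewrite -ltnS.
  have exc0 : 0 <= excursions S x (n - a).
    by case: (n - a)%N => //= m; apply: sumr_ge0 => y _; exact: walks_ge0.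
  apply: (le_trans (ler_pM (walks_to_ge0 _ _ _) exc0 (closed a x) (excE _ (leq_subr _ _)))).
  have -> : lambda ^+ n = lambda ^+ a * lambda ^+ (n - a) by rewrite -exprD subnKC.
  rewrite /K le_eqVlt; apply/orP; left; apply/eqP; ring.
rewrite sumr_const card_ord -[leLHS]mulr_natl exprS.
by rewrite le_eqVlt; apply/orP; left; apply/eqP; ring.
Qed.

(** Otherwise closed walks would be bounded by [C * lambda ^+ a] at every length [a]: the sum in [C]
    covers the finitely many lengths below [M], the summand 1 the others. Then [walks_le] would
    bound all walks by a polynomial times [lambda ^+ n]. *)
Lemma closed_walks_growth (lambda : R) : 0 < lambda ->
  (forall K : R, exists n, K * n.+1%:R ^+ #|V| * lambda ^+ n < \sum_x walks [set: V]%SET n x) ->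
  forall M, exists a v, (M <= a)%N /\ lambda ^+ a < walks_to v a v.
Proof.
move=> l0 growth M; apply: contrapT => nowalk.
pose C : R := \sum_(a < M) (\sum_v walks_to v a v) / lambda ^+ a + 1.
have s0 (a : nat) : 0 <= (\sum_v walks_to v a v) / lambda ^+ a.
  apply: divr_ge0; last by rewrite exprn_ge0// ltW.
  by apply: sumr_ge0 => v _; exact: walks_to_ge0.
have C1 : 1 <= C by rewrite lerDr sumr_ge0.
have closed a v : walks_to v a v <= C * lambda ^+ a.
  have [aM|Ma] := ltnP a M; last first.
    have := ltP (lambda ^+ a) (walks_to v a v) => -[lv|].
      by case: nowalk; exists a, v.
    by move=> /le_trans; apply; rewrite ler_peMl// exprn_ge0// ltW.
  rewrite -ler_pdivrMr ?exprn_gt0//.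
  apply: le_trans (_ : (\sum_v walks_to v a v) / lambda ^+ a <= _).
    apply: ler_wpM2r; first by rewrite invr_ge0 exprn_ge0// ltW.
    by rewrite (bigD1 v)//= lerDl sumr_ge0// => y _; exact: walks_to_ge0.
  rewrite /C (bigD1 (Ordinal aM))//= -addrA lerDl; apply: addr_ge0 => //.
  by apply: sumr_ge0 => i _; exact: s0.
have [n] := growth (#|V|%:R * (C * (#|V|%:R / lambda + 1)) ^+ #|V|).
rewrite ltNge => /negP; apply.
apply: le_trans (ler_sum _ (fun x _ => walks_le C1 l0 closed [set: V]%SET n x)) _.
rewrite sumr_const -[leLHS]mulr_natl exprMn cardsT -[#|xpredT|]/#|V|.
by rewrite le_eqVlt; apply/orP; left; apply/eqP; ring.
Qed.

Lemma walksE n x : walks [set: V]%SET n x = \sum_(t : n.-tuple V) (path e x t)%:R.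
Proof.
elim: n x => [|n IH] x /=; rewrite inE.
  by rewrite (sum_tuple0 (fun t => (path e x t)%:R)).
rewrite (sum_tupleS (fun t => (path e x t)%:R)) big_mkcond; apply: eq_bigr => y _ /=.
rewrite IH; case: (e x y) => //=.
by rewrite big1.
Qed.

Lemma walks_toE v n x :
  walks_to v n x = \sum_(t : n.-tuple V) (path e x t && (last x t == v))%:R.
Proof.
elim: n x => [|n IH] x /=.
  by rewrite (sum_tuple0 (fun t => (path e x t && (last x t == v))%:R)).
rewrite (sum_tupleS (fun t => (path e x t && (last x t == v))%:R)) big_mkcond.
apply: eq_bigr => y _ /=; rewrite IH; case: (e x y) => //=.
by rewrite big1.
Qed.

End ClosedWalks.

(** The term of degree [d.+1] in the exponential series outgrows a polynomial of degree [d]; the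
    constant [c] also pays for [n.+1 <= 2 * n]. *)
Lemma expR_dominates (R : realType) (K e : R) (d : nat) : 0 < e ->
  exists n : nat, K * n.+1%:R ^+ d < expR (e * n%:R).
Proof.
move=> e0; pose c := `|K| * 2 ^+ d * (d.+1)`!%:R / e ^+ d.+1.
have /(_ _)/filter_ex[n [/= cn n0]] :=
  filterI (nbhs_infty_gtr c) (nbhs_infty_gt 0).
exists n; have nR : 0 < n%:R :> R by rewrite ltr0n.
have en : 0 <= e * n%:R by rewrite mulr_ge0// ltW.
have := expR_ge1Dxn d en; apply: lt_le_trans.
have f0 : 0 < (d.+1)`!%:R :> R by rewrite ltr0n fact_gt0.
have ed : 0 < e ^+ d.+1 by rewrite exprn_gt0.
apply: (@le_lt_trans _ _ ((e * n%:R) ^+ d.+1 / (d.+1)`!%:R)); last by rewrite ltrDr.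
apply: (@le_trans _ _ (`|K| * (2 * n%:R) ^+ d)).
  apply: le_trans (ler_wpM2r _ (ler_norm K)) _; first by rewrite exprn_ge0.
  apply: ler_wpM2l => //; apply: lerXn2r; rewrite ?nnegrE ?mulr_ge0//.
  by rewrite -natrM ler_nat; lia.
rewrite ler_pdivlMr// !exprMn [n%:R ^+ d.+1]exprSr !mulrA.
move: cn; rewrite /c ltr_pdivrMr// => /ltW cn.
have nd : 0 <= n%:R ^+ d :> R by rewrite exprn_ge0.
have := ler_wpM2r nd cn.
have -> : `|K| * 2 ^+ d * (d.+1)`!%:R * n%:R ^+ d = `|K| * 2 ^+ d * n%:R ^+ d * (d.+1)`!%:R by ring.
by have -> : n%:R * e ^+ d.+1 * n%:R ^+ d = e ^+ d.+1 * n%:R ^+ d * n%:R by ring.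
Qed.

Lemma sum_indicator (R : realType) (T : finType) (P : pred T) :
  \sum_t (P t)%:R = #|[set t | P t]%SET|%:R :> R.
Proof.
rewrite -sum1_card natr_sum [RHS]big_mkcond; apply: eq_bigr => t _.
by rewrite inE; case: (P t).
Qed.

(** * Periodic sequences *)

Section Loops.
Variables (A : finType) (X : subshift A).
Implicit Types (n N : nat).

(** The period is [N.+1], so the modulus is nonzero and the index type inhabited. *)
Definition per N (f : {ffun 'I_N.+1 -> A}) (i : int) : A :=
  f (inord (absz (i %% N.+1%:Z)%Z)).

Lemma absz_mod N (i : int) : (absz (i %% N.+1%:Z)%Z)%:Z = (i %% N.+1%:Z)%Z.
Proof. by rewrite gez0_abs// modz_ge0. Qed.

Lemma absz_mod_lt N (i : int) : (absz (i %% N.+1%:Z)%Z < N.+1)%N.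
Proof. by rewrite -ltz_nat absz_mod ltz_pmod. Qed.

Lemma per_period N (f : {ffun 'I_N.+1 -> A}) i : per f (i + N.+1%:Z) = per f i.
Proof. by rewrite /per modzDr. Qed.

Lemma per_ord N (f : {ffun 'I_N.+1 -> A}) (k : 'I_N.+1) : per f k%:Z = f k.
Proof.
rewrite /per modz_small; last by rewrite lez_nat ltz_nat ltn_ord.
by rewrite absz_nat inord_val.
Qed.

Lemma per_inj N (f g : {ffun 'I_N.+1 -> A}) : per f =1 per g -> f = g.
Proof. by move=> fg; apply/ffunP => k; rewrite -!per_ord. Qed.

Definition loops n N : {set {ffun 'I_N.+1 -> A}} :=
  [set f | `[< locally_in X n (per f) >]].

Lemma loopsP n N (f : {ffun 'I_N.+1 -> A}) :
  reflect (locally_in X n (per f)) (f \in loops n N).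
Proof. by rewrite inE; exact: asboolP. Qed.

(** The edges of the Rauzy graph of [X]: bi-infinite walks spell the sequences that satisfy
    [locally_in X n.+1]. *)
Definition overlap n : rel (n.+1.-tuple A) := fun u v =>
  [&& u \in Lang X n.+1, v \in Lang X n.+1 & behead u == take n v].

Lemma overlap_word n (u : int -> n.+1.-tuple A) :
  (forall i, overlap (u i) (u (i + 1))) ->
  forall i, word (fun j => thead (u j)) i n.+1 = u i.
Proof.
move=> ov i; pose a := thead (u i).
have nthu k : (k < n.+1)%N -> forall j, nth a (u j) k = thead (u (j + k%:Z)).
  elim: k => [|k IH] kn j; first by rewrite addr0 {1}(tuple_eta (u j)).
  have /and3P[_ _ /eqP e] := ov j.
  rewrite -nth_behead e nth_take// IH; last exact: ltnW.
  by congr (thead (u _)); lia.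
apply: (@eq_from_nth _ a); first by rewrite size_word size_tuple.
by move=> k; rewrite size_word => kn; rewrite nth_word// nthu.
Qed.

Lemma closed_walks_le_loops (R : realType) n N (v : n.+1.-tuple A) :
  walks_to R (@overlap n) v N.+1 v <= #|loops n.+1 N|%:R.
Proof.
rewrite walks_toE sum_indicator ler_nat.
set W := [set t | _]%SET.
(* The tuple [t] omits the starting vertex [v] but ends at [v], so its periodic repetition is again
   a walk. *)
pose u (t : N.+1.-tuple (n.+1.-tuple A)) (i : int) := nth v t (absz (i %% N.+1%:Z)%Z).
pose F (t : N.+1.-tuple (n.+1.-tuple A)) := [ffun k : 'I_N.+1 => thead (nth v t k)].
have ov t : t \in W -> forall i, overlap (u t i) (u t (i + 1)).
  rewrite inE => /andP[/(pathP v) pt /eqP lt] i; rewrite /u.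
  have := absz_mod_lt N i; have := absz_mod N i; set r := absz _ => ri rN.
  have [rN'|rN'] := ltnP r.+1 N.+1.
    have -> : absz ((i + 1) %% N.+1%:Z)%Z = r.+1.
      by rewrite -modzDml -ri modz_small ?absz_nat; lia.
    by have := pt r.+1; rewrite size_tuple => /(_ rN').
  have eN : r = N by lia.
  have -> : absz ((i + 1) %% N.+1%:Z)%Z = 0%N.
    rewrite -modzDml -ri eN; have -> : N%:Z + 1 = N.+1%:Z by lia.
    by rewrite modzz.
  have := pt 0%N; rewrite size_tuple => /(_ isT) /=.
  have -> : nth v t r = last v t by rewrite (last_nth v) size_tuple eN.
  by rewrite lt.
have perF t i : per (F t) i = thead (u t i).
  by rewrite /per ffunE inordK// absz_mod_lt.
have wordF t i : t \in W -> word (per (F t)) i n.+1 = u t i.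
  move=> tW; rewrite -(overlap_word (ov t tW)); apply: eq_word => k _; exact: perF.
rewrite -(card_in_imset (f := F)).
  apply/subset_leq_card/fintype.subsetP => _ /imsetP[t tW ->].
  apply/loopsP => i; rewrite wordF//; apply/in_Lang.
  by have /and3P[] := ov t tW i.
move=> s t sW tW st; apply: val_inj; apply: (@eq_from_nth _ v).
  by rewrite !size_tuple.
move=> k; rewrite size_tuple => kN; apply: val_inj.
have uk w : u w k%:Z = nth v w k.
  by rewrite /u modz_small ?absz_nat// lez_nat ltz_nat.
by rewrite -!uk /= -!wordF// st.
Qed.

Lemma Lang_le_walks (R : realType) n N : #|Lang X (n.+1 + N)|%:R <=
  \sum_x walks R (@overlap n) [set: n.+1.-tuple A]%SET N x.
Proof.
under eq_bigr do rewrite walksE.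
rewrite pair_big /=.
rewrite (sum_indicator R (fun p : n.+1.-tuple A * N.-tuple _ => path (@overlap n) p.1 p.2)).
rewrite ler_nat; set W := [set p | _]%SET.
(* The word spelled by a walk: its first vertex, then the last letter of each later vertex. *)
pose H (p : n.+1.-tuple A * N.-tuple (n.+1.-tuple A)) : (n.+1 + N).-tuple A :=
  [tuple of p.1 ++ [seq tnth w ord_max | w : n.+1.-tuple A <- p.2]].
apply: leq_trans (leq_imset_card H W).
apply/subset_leq_card/fintype.subsetP => w /in_Lang /(languageP 0)[x wx].
rewrite size_tuple in wx.
pose t := [tuple tword (crd x) (i.+1%:Z) n.+1 | i < N].
have nt v j : (j < N)%N -> nth v t j = tword (crd x) j.+1%:Z n.+1.
  by move=> jN; rewrite -(tnth_nth v t (Ordinal jN)) tnth_mktuple.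
apply/imsetP; exists (tword (crd x) 0 n.+1, t).
  rewrite inE; apply/(pathP (tword (crd x) 0 n.+1)) => j; rewrite size_tuple => jN.
  have -> : nth (tword (crd x) 0 n.+1) (tword (crd x) 0 n.+1 :: t) j = tword (crd x) j%:Z n.+1.
    by case: j jN => [|j] jN //=; rewrite nt// ltnW.
  rewrite (nt _ _ jN) /overlap !tword_Lang; apply/eqP.
  rewrite -[LHS]/(behead (word (crd x) j%:Z n.+1)).
  rewrite word_cons.
  have -> : tword (crd x) j.+1%:Z n.+1 = rcons _ _ :> seq A := word_rcons _ _ _.
  rewrite -cats1 take_size_cat ?size_word//.
  by apply: eq_word => k _; congr (crd x _); lia.
apply: val_inj; rewrite [LHS]wx.
have -> : \val (H (tword (crd x) 0 n.+1, t)) =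
  word (crd x) 0 n.+1 ++ [seq tnth w ord_max | w : n.+1.-tuple A <- t] by [].
rewrite word_cat; congr (_ ++ _).
apply: (@eq_from_nth _ (crd x 0)); first by rewrite size_word size_map size_tuple.
move=> j; rewrite size_word => jN.
rewrite nth_word// (nth_map (tword (crd x) 0 n.+1)) ?size_tuple// nt//.
by rewrite (tnth_nth (crd x 0)) /= nth_word//; congr (crd x _); lia.
Qed.

(** Walks of length [m] number at least [expR (h * m%:R)]. With [lambda = expR (h - e)] this leaves
    a factor [expR (e * m%:R)], which beats the polynomial loss in passing to closed walks. *)
Lemma loops_growth (R : realType) (h e : R) n : 0 <= h -> 0 < e ->
  (forall m, h * m%:R <= ln #|Lang X m|%:R) ->
  forall M, exists N, [/\ (M <= N)%N, (0 < #|loops n.+1 N|)%N &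
    (h - e) * N.+1%:R <= ln #|loops n.+1 N|%:R].
Proof.
move=> h0 e0 hL M.
have [] := @closed_walks_growth R _ (@overlap n) (expR (h - e)) (expR_gt0 _) _ M.+1.
  move=> K; have [m mK] := expR_dominates K #|{: n.+1.-tuple A}| e0.
  exists m; apply: lt_le_trans (Lang_le_walks R n m).
  apply: (@lt_le_trans _ _ (expR (h * m%:R))).
    have -> : expR (h * m%:R) = expR (e * m%:R) * expR (h - e) ^+ m.
      by rewrite -expRM_natr -expRD; congr expR; ring.
    by rewrite ltr_pM2r// exprn_gt0// expR_gt0.
  rewrite -[leRHS]lnK ?posrE ?ltr0n ?card_Lang_gt0// ler_expR.
  apply: le_trans (hL _); rewrite ler_wpM2l// ler_nat; lia.
move=> [|N] [v [MN vN]]; first by [].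
exists N.
have L0 : expR (h - e) ^+ N.+1 < #|loops n.+1 N|%:R.
  exact: lt_le_trans vN (closed_walks_le_loops _ _ _).
have l0 : 0 < #|loops n.+1 N|%:R :> R by apply: lt_trans L0; rewrite exprn_gt0// expR_gt0.
split; [by []|by rewrite -(ltr0n R)|].
rewrite -ler_expR lnK ?posrE//; apply: ltW; apply: le_lt_trans L0.
by rewrite -expRM_natl mulrC.
Qed.

End Loops.

(** * Automorphisms act on periodic sequences *)

Section BlockMaps.
Variables (A : finType) (X : subshift A).
Implicit Types (y : int -> A) (x : points X) (m r s : nat).

Definition slide (i : int) y : int -> A := fun j => y (j + i).

Lemma slideD i j y : slide i (slide j y) = slide (i + j) y.
Proof. by apply/funext => k; rewrite /slide addrA. Qed.

Lemma slide0 y : slide 0 y = y.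
Proof. by apply/funext => k; rewrite /slide addr0. Qed.

Lemma locally_inP m y :
  locally_in X (m + m).+1 y <-> forall i, exists x, agree m (slide i y) (crd x).
Proof.
split=> ly i.
  have [x] := languageP (- m%:Z) (ly (i - m%:Z)); rewrite size_word => /word_inj yx.
  exists x => j jm.
  have jm' : (absz (j + m%:Z)%R < (m + m).+1)%N by lia.
  have := yx _ jm'; have -> : (absz (j + m%:Z)%R)%:Z = j + m%:Z by lia.
  rewrite /slide; have -> : i - m%:Z + (j + m%:Z) = j + i by ring.
  by have -> : - m%:Z + (j + m%:Z) = j by ring.
have [x yx] := ly (i + m%:Z).
have -> : word y i (m + m).+1 = word (crd x) (- m%:Z) (m + m).+1.
  apply: eq_word => k km; rewrite -yx; last by lia.
  by rewrite /slide; congr (y _); ring.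
exact: language_word.
Qed.

(** A noncanonical choice: only the coordinates within radius [m] are controlled, and the value is
    the default [point] if no point of [X] matches. *)
Definition retract m y : points X := xget point [set x | agree m y (crd x)].

Lemma retractP m y x : agree m y (crd x) -> agree m y (crd (retract m y)).
Proof. by move=> yx; apply: (xgetPex point (P := [set x | agree m y (crd x)])); exists x. Qed.

Lemma crd_translate (psi : points X -> points X) x x' i :
  (forall z, psi (points_shift z) = points_shift (psi z)) ->
  crd x' = slide i (crd x) -> crd (psi x') = slide i (crd (psi x)).
Proof.
move=> psiS.
have psi_iter n z : psi (iter n (@points_shift A X) z) = iter n (@points_shift A X) (psi z).
  by elim: n => //= n IH; rewrite psiS IH.
have pos n z z' : crd z' = slide n%:Z (crd z) -> crd (psi z') = slide n%:Z (crd (psi z)).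
  move=> zz'; have -> : z' = iter n (@points_shift A X) z.
    by apply/crd_inj/funext => j; rewrite zz' iter_points_shift.
  by rewrite psi_iter; apply/funext => j; rewrite iter_points_shift.
case: i => n; first exact: pos.
rewrite NegzE => xx'.
(* For a negative shift [x] and [x'] exchange roles. *)
rewrite (pos n.+1 x' x); first by rewrite slideD addNr slide0.
by rewrite xx' slideD subrr slide0.
Qed.

Section Map.
Variables (psi : points X -> points X) (r : nat).
Hypothesis psiS : forall z, psi (points_shift z) = points_shift (psi z).
Hypothesis psi_window : forall x z, agree r (crd x) (crd z) -> crd (psi x) 0 = crd (psi z) 0.

(** The sliding block code of [psi], extended to sequences outside [X]. The choice made by [retract]
    is harmless wherever the window of radius [r] occurs in [X], by [psi_window]. *)
Definition block_map y : int -> A := fun i => crd (psi (retract r (slide i y))) 0.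

Lemma block_map_slide i y : block_map (slide i y) = slide i (block_map y).
Proof. by apply/funext => j; rewrite /block_map slideD. Qed.

Lemma block_map_agree s y x :
  agree (s + r) y (crd x) -> agree s (block_map y) (crd (psi x)).
Proof.
move=> yx j js; have [x' xx'] := translate x j.
have yx' : agree r (slide j y) (crd x').
  by move=> k kr; rewrite xx' /slide yx//; lia.
have /agree_sym rx' := retractP yx'.
rewrite /block_map (psi_window (agree_trans rx' yx')).
have := @crd_translate psi x x' j psiS; rewrite /slide => ->; first by rewrite add0r.
exact/funext.
Qed.

Lemma block_map_locally m y : locally_in X ((m + r) + (m + r)).+1 y ->
  locally_in X (m + m).+1 (block_map y).
Proof.
move=> /locally_inP ly; apply/locally_inP => i; have [x yx] := ly i.
by exists (psi x); rewrite -block_map_slide; exact: block_map_agree.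
Qed.

End Map.

(** Coordinate [i] of the composite sees only the window of radius [r' + r] around [i], where [y]
    coincides with a point of [X] to which [psiK] applies. *)
Lemma block_mapK (psi phi : points X -> points X) (r r' : nat) y :
  (forall z, psi (points_shift z) = points_shift (psi z)) ->
  (forall z, phi (points_shift z) = points_shift (phi z)) ->
  (forall x z, agree r (crd x) (crd z) -> crd (psi x) 0 = crd (psi z) 0) ->
  (forall x z, agree r' (crd x) (crd z) -> crd (phi x) 0 = crd (phi z) 0) ->
  cancel psi phi -> locally_in X ((r' + r) + (r' + r)).+1 y ->
  block_map phi r' (block_map psi r y) = y.
Proof.
move=> psiS phiS psiW phiW psiK /locally_inP ly; apply/funext => i.
have [x yx] := ly i; have yx1 := block_map_agree psiS psiW yx.
have yx0 := block_map_agree (s := 0) phiS phiW yx1.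
have := yx0 0 isT; rewrite psiK !block_map_slide /slide add0r => ->.
by rewrite -yx// /slide add0r.
Qed.

Section Loops.
Variables (psi : points X -> points X) (r : nat) (N : nat).
Implicit Types f g : {ffun 'I_N.+1 -> A}.

Lemma per_ffun y : (forall i, y (i + N.+1%:Z) = y i) ->
  per [ffun k : 'I_N.+1 => y k%:Z] = y.
Proof.
move=> yN; have yNn n i : y (i + n%:Z * N.+1%:Z) = y i.
  elim: n i => [|n IH] i; first by rewrite mul0r addr0.
  have -> : i + n.+1%:Z * N.+1%:Z = i + n%:Z * N.+1%:Z + N.+1%:Z by lia.
  by rewrite yN.
apply/funext => i; rewrite /per ffunE inordK ?absz_mod_lt// absz_mod.
have := divz_eq i N.+1%:Z; set q := (i %/ _)%Z; set j := (i %% _)%Z => ->.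
case: q => n; first by rewrite addrC yNn.
rewrite -(yNn n.+1 (Negz n * _ + j)); congr (y _); rewrite NegzE; ring.
Qed.

Definition loop_map f : {ffun 'I_N.+1 -> A} :=
  [ffun k : 'I_N.+1 => block_map psi r (per f) k%:Z].

Lemma per_loop_map f : per (loop_map f) = block_map psi r (per f).
Proof.
apply: per_ffun => i.
rewrite -[LHS]/(slide N.+1%:Z (block_map psi r (per f)) i) -block_map_slide.
by congr (block_map psi r _ i); apply/funext => j; rewrite /slide per_period.
Qed.

End Loops.
End BlockMaps.

(** An injection of a finite set into itself is a permutation, so it preserves the uniform
    measure. *)
Lemma card_preim_inj (T : finType) (S : {set T}) (h : T -> T) (P : pred T) :
  {in S &, injective h} -> (forall t, t \in S -> h t \in S) ->
  #|[set t in S | P (h t)]%SET| = #|[set t in S | P t]%SET|.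
Proof.
move=> hinj hS.
have hSS : h @: S = S.
  apply/eqP; rewrite eqEcard card_in_imset// leqnn andbT.
  by apply/fintype.subsetP => _ /imsetP[t tS ->]; exact: hS.
rewrite -(card_in_imset (f := h)); last first.
  by move=> s t; rewrite !inE => /andP[sS _] /andP[tS _]; exact: hinj.
congr #|pred_of_set _|; apply/setP => t; rewrite inE; apply/imsetP/andP.
  by move=> [s + ->]; rewrite inE => /andP[/hS].
move=> [tS Pt]; move: (tS); rewrite -{1}hSS => /imsetP[s sS ts].
by exists s => //; rewrite inE sS -ts.
Qed.

(** * Empirical measures and their invariance *)

Section Empirical.
Variables (R : realType) (A : finType) (X : subshift A).

Definition window_loops m N := loops X (m + m).+1 N.

(* The uniform measure on the periodic sequences all of whose windows of
   radius m occur in X, pushed to X by an arbitrary choice of nearby points. *)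
Definition empirical m N (C : set (points X)) : R :=
  #|[set f in window_loops m N | `[< C (retract X m (per f)) >]]%SET|%:R
    / #|window_loops m N|%:R.

(** The approximating shifts of finite type for window radii [m] and [m + k] coincide. *)
Definition gap (k m : nat) : Prop := forall y, locally_in X (m + m).+1 y ->
  locally_in X ((m + k) + (m + k)).+1 y.

Lemma language_stable_gap : language_stable R X ->
  forall k, exists2 m, (k <= m)%N & gap k m.
Proof.
(* A radius gain of [k] needs [2k] lengths; the two extra ones allow rounding [n] to the odd window
   length [(n./2).*2.+1], which is [n] or [n.+1]. *)
move=> /dense_run run k; have [n kn nS] := run k.+1.*2.
exists n./2; first by lia.
move=> y ly; apply: (locally_in_gap (n := (n./2 + n./2).+1) (k := k + k) _ ly).
  by move=> l ll; apply: nS; lia.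
by lia.
Qed.

Lemma locally_in_le m n y : (m <= n)%N ->
  locally_in X (n + n).+1 y -> locally_in X (m + m).+1 y.
Proof.
move=> mn /locally_inP ly; apply/locally_inP => i; have [x yx] := ly i.
by exists x; exact: agree_le yx.
Qed.

Lemma automorphism_inv (psi : points X -> points X) : automorphism psi ->
  exists phi : points X -> points X, [/\ continuous phi, cancel psi phi &
   forall x, phi (points_shift x) = points_shift (phi x)].
Proof.
move=> [_ [phi [cphi psiK phiK]] psiS]; exists phi; split=> // x.
by apply: (can_inj psiK); rewrite phiK psiS phiK.
Qed.

(** The gap enlarges the radius before the block map consumes [r] of it, so the loop map stays in
    [S]; it is injective because radius [r' + r] suffices to undo it. For a loop [f], both
    [psi (retract f)] and the retraction of the image loop agree with that image on radius [w], so a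
    set of window [w] does not distinguish them. *)
Lemma empirical_invariant (psi : points X -> points X) : automorphism psi ->
  exists k, forall w C, windowed w C -> forall m N, (w + k <= m)%N -> gap k m ->
    empirical m N (psi @^-1` C) = empirical m N C.
Proof.
move=> apsi; have [cpsi _ psiS] := apsi.
have [phi [cphi psiK phiS]] := automorphism_inv apsi.
have [r psiW] := continuous_window cpsi; have [r' phiW] := continuous_window cphi.
exists (r' + r)%N => w C wC m N wm gm; rewrite /empirical; congr (_%:R / _).
pose S := window_loops m N; pose h := @loop_map A X psi r N.
have retP f : f \in S -> agree m (per f) (crd (retract X m (per f))).
  move=> /loopsP/locally_inP/(_ 0)[x]; rewrite slide0; exact: retractP.
have hS f : f \in S -> h f \in S.
  move=> /loopsP/gm lf; apply/loopsP; rewrite per_loop_map.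
  apply: block_map_locally => //.
  by apply: locally_in_le lf; lia.
have hinj : {in S &, injective h}.
  move=> f g /loopsP fS /loopsP gS fg; apply: per_inj => i.
  rewrite -(block_mapK psiS phiS psiW phiW psiK (y := per f)); last first.
    by apply: locally_in_le fS; lia.
  rewrite -[RHS](@f_equal _ _ (fun y => y i) _ _
    (block_mapK psiS phiS psiW phiW psiK (y := per g) _)); last first.
    by apply: locally_in_le gS; lia.
  by rewrite -!per_loop_map -/(h f) fg.
rewrite -(card_preim_inj (fun f => `[< C (retract X m (per f)) >]) hinj hS).
congr #|pred_of_set _|; apply/setP => f; rewrite !inE; apply: andb_id2l => lf.
have {lf}fS : f \in S by rewrite inE.
apply: asbool_equiv_eq.
have wr : agree w (per (h f)) (crd (psi (retract X m (per f)))).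
  rewrite per_loop_map; apply: block_map_agree => //.
  by apply: agree_le (retP f fS); lia.
have wr' : agree w (per (h f)) (crd (retract X m (per (h f)))).
  by apply: agree_le (retP _ (hS f fS)); lia.
split; first exact: wC (agree_trans (agree_sym wr) wr').
exact: wC (agree_trans (agree_sym wr') wr).
Qed.

Lemma continuous_agree (psi : points X -> points X) :
  (forall m, exists n, forall x y,
    agree n (crd x) (crd y) -> agree m (crd (psi x)) (crd (psi y))) ->
  continuous psi.
Proof.
move=> psiW; apply/continuousP => V /open_bigcup_cylindrical[C cC ->].
rewrite preimage_bigcup; apply: bigcup_open => n _; apply: cylindrical_open.
have [m mC] := cC n; have [k kP] := psiW m.
by exists k => x y /kP; exact: mC.
Qed.

Lemma shift_automorphism : automorphism (@points_shift A X).
Proof.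
have [phi phiK] := choice (@shift_preimage A X).
have shiftE (x : points X) i : crd (points_shift x) i = crd x (i + 1) by [].
have phiE (x : points X) i : crd (phi x) i = crd x (i - 1).
  by rewrite -{2}(phiK x) shiftE subrK.
split=> //.
  apply: continuous_agree => m; exists m.+1 => x y xy i im.
  by rewrite !shiftE xy//; lia.
exists phi; split=> //.
  apply: continuous_agree => m; exists m.+1 => x y xy i im.
  by rewrite !phiE xy//; lia.
by move=> x; apply/crd_inj/funext => i; rewrite phiE shiftE subrK.
Qed.

End Empirical.

(** * Topological entropy *)

Section TopologicalEntropy.
Variables (R : realType) (A : finType) (X : subshift A).

Local Notation ln_Lang n := (ln #|Lang X n|%:R : R).

Lemma ln_Lang_ge0 n : 0 <= ln_Lang n.
Proof. by rewrite ln_ge0// ler1n card_Lang_gt0. Qed.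

Lemma ln_LangD m n : ln_Lang (m + n) <= ln_Lang m + ln_Lang n.
Proof.
rewrite -lnM ?posrE ?ltr0n ?card_Lang_gt0// -natrM.
by rewrite ler_ln ?posrE ?ltr0n ?muln_gt0 ?card_Lang_gt0// ler_nat card_LangD.
Qed.

Lemma language_entropy : exists h : R,
  [/\ 0 <= h, (fun n => ln_Lang n / n%:R) @ \oo --> h & forall n, h * n%:R <= ln_Lang n].
Proof.
have [h hlim hinf] := fekete ln_Lang_ge0 ln_LangD.
have hn n : h * n%:R <= ln_Lang n.
  case: n => [|n]; first by rewrite mulr0 ln_Lang_ge0.
  by rewrite -ler_pdivlMr// hinf.
exists h; split=> //; rewrite -(cvg_lim (@norm_hausdorff _ _) hlim).
apply: limr_ge; first exact: cvgP hlim.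
by apply: nearW => n; rewrite divr_ge0// ln_Lang_ge0.
Qed.

Local Notation T := (@points_shift A X).

(** Membership is kept inside the existential so that [choice] yields a function on all tuples. *)
Lemma point_of_word k n (w : n.-tuple A) : exists x : points X,
  w \in Lang X n -> w = word (crd x) k n :> seq A.
Proof.
have [/in_Lang/(languageP k)[x wx]|] := boolP (w \in Lang X n); last by exists point.
by exists x; rewrite {1}wx size_tuple.
Qed.

(** The letters at positions from [-w] to [n + w - 1] determine cover elements for the first [n]
    shifts, so one representative point per word yields a subcover. *)
Lemma subcover_number_le (U : set (set (points X))) w n :
  (forall x : points X, exists2 V, U V & forall y, agree w (crd x) (crd y) -> V y) ->
  (subcover_number R (cover_join T U n) <= #|Lang X (n + w.*2)|%:R%:E)%E.
Proof.
move=> wU.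
have /choice[V VP] : forall x : points X, exists V, U V /\
    forall y, agree w (crd x) (crd y) -> V y.
  by move=> x; have [V UV VP] := wU x; exists V.
have UV x : U (V x) by case: (VP x).
have wV x y : agree w (crd x) (crd y) -> V x y by case: (VP x) => _; apply.
have /choice[x xP] := @point_of_word (- w%:Z) (n + w.*2).
pose B W := \bigcap_(i : 'I_n) (iter i T @^-1` V (iter i T (x W))).
pose F := seq_fset tt [seq B W | W <- enum (Lang X (n + w.*2))].
apply: (@le_trans _ _ (#|` F|%:R : R)%:E); last first.
  rewrite lee_fin ler_nat size_seq_fset; apply: leq_trans (size_undup _) _.
  by rewrite size_map -cardE.
apply: ereal_inf_lbound; exists F => //; split.
  move=> C CF; have {CF} : C \in F by [].
  rewrite seq_fsetE => /mapP[W _ ->].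
  by exists (fun i : 'I_n => V (iter i T (x W))).
apply/seteqP; split=> // y _.
pose W := tword (crd y) (- w%:Z) (n + w.*2).
exists (B W).
  suff : B W \in F by [].
  by rewrite seq_fsetE; apply/mapP; exists W => //; rewrite mem_enum tword_Lang.
move=> i _ /=; apply: wV => j jw.
rewrite !iter_points_shift.
have yx : word (crd y) (- w%:Z) (n + w.*2) = word (crd (x W)) (- w%:Z) (n + w.*2).
  exact: (xP W (tword_Lang _ _ _)).
have := word_inj yx.
move=> /(_ (absz (j + i%:Z + w%:Z)%R)).
have -> : - w%:Z + (absz (j + i%:Z + w%:Z)%R)%:Z = j + i%:Z by lia.
by move=> ->//; have := ltn_ord i; lia.
Qed.

Definition letter_cover : set (set (points X)) :=
  [set [set x : points X | crd x 0 = a] | a in setT].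

Lemma letter_cover_open : open_cover letter_cover.
Proof.
split.
  by move=> _ [a _ <-]; apply: cylindrical_open; exists 0%N => x y xy /= <-; rewrite xy.
by apply/seteqP; split=> // x _; exists [set y | crd y 0 = crd x 0] => //; exists (crd x 0).
Qed.

(** The lower bound holds because an element of the join fixes the first [n] letters, so points with
    different words need different elements. *)
Lemma subcover_number_letters n :
  subcover_number R (cover_join T letter_cover n) = #|Lang X n|%:R%:E.
Proof.
apply/eqP; rewrite eq_le; apply/andP; split.
  have := @subcover_number_le letter_cover 0 n; rewrite double0 addn0; apply.
  move=> x; exists [set y | crd y 0 = crd x 0]; first by exists (crd x 0).
  by move=> y xy /=; rewrite xy.
apply: le_ereal_inf_tmp => _ [F [FU cF] <-]; rewrite lee_fin ler_nat.
have /choice[x xP] := @point_of_word 0 n.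
have /choice[B BP] : forall w : n.-tuple A, exists B, B \in F /\ B (x w).
  move=> w; have : is_cover [set` F] by [].
  move=> /seteqP[_ /(_ (x w) I)] [B BF Bx]; by exists B.
have Binj : {in Lang X n &, injective B}.
  move=> v w vL wL Bvw; have [BF Bv] := BP v; have [_ Bw] := BP w.
  rewrite -Bvw in Bw; have [V VU BE] := FU _ BF.
  apply: val_inj; rewrite /= (xP v vL) (xP w wL); apply: eq_word => k kn.
  rewrite -BE in Bv Bw.
  have := Bv (Ordinal kn) I; have := Bw (Ordinal kn) I.
  have [a _ <-] := VU (Ordinal kn); rewrite /preimage /mkset !iter_points_shift.
  by move=> -> ->.
rewrite cardE -(size_map B).
apply: uniq_leq_size.
  by rewrite map_inj_in_uniq ?enum_uniq// => v w; rewrite !mem_enum; exact: Binj.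
by move=> _ /mapP[w _ ->]; case: (BP w).
Qed.

Lemma topological_entropyE (h : R) : 0 <= h ->
  (fun n => ln_Lang n / n%:R) @ \oo --> h -> topological_entropy R T = h%:E.
Proof.
move=> h0 hlim; apply/eqP; rewrite eq_le; apply/andP; split; last first.
  apply: ereal_sup_ubound; exists letter_cover; first exact: letter_cover_open.
  rewrite /entropy_of_cover (_ : (fun n => _) = EFin \o (fun n => ln_Lang n / n%:R)).
    by apply: cvg_lim => //; apply: cvg_EFin => //; exact: nearW.
  apply/funext => n; rewrite subcover_number_letters lne_EFin ?EFinM//.
  by rewrite ltr0n card_Lang_gt0.
apply: ge_ereal_sup => _ [U oU <-].
have [w wU] := lebesgue_window oU.
pose g n := ln_Lang n / n%:R + ln_Lang w.*2 / n%:R.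
have glim : (EFin \o g) @ \oo --> h%:E.
  apply: cvg_EFin; first exact: nearW.
  rewrite -[h]addr0; apply: cvgD => //.
  rewrite -(mulr0 (ln_Lang w.*2)); apply: cvgM; first exact: cvg_cst.
  by rewrite -cvg_shiftS; exact: cvg_harmonic.
rewrite /entropy_of_cover; set s := fun n => _.
have sg n : (s n <= (EFin \o g) n)%E.
  rewrite /s /= /g -mulrDl EFinM; apply: lee_wpmul2r; first by rewrite lee_fin.
  apply: (@le_trans _ _ (lne (#|Lang X (n + w.*2)|%:R%:E))).
    rewrite lee_lne ?in_itv/= ?leey ?andbT ?lee_fin//; first exact: subcover_number_le.
    by apply: le_ereal_inf_tmp => _ [F _ <-]; rewrite lee_fin.
  by rewrite lne_EFin ?ltr0n ?card_Lang_gt0// lee_fin ln_LangD.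
(* Without convergence [limn] takes the default value 0, which is at most [h]. *)
have [cs|ncs] := pselect (cvg (s @ \oo)); last by rewrite dvgP// lee_fin.
rewrite -(cvg_lim _ glim)//; apply: lee_lim => //; first exact: cvgP glim.
exact: nearW.
Qed.

End TopologicalEntropy.

(** * Upper bound for measure entropy *)

Section FiniteMaps.
Context d (T : measurableType d) (R : realType) (mu : probability T R).
Implicit Types (B C : set T) (I J : finType).

Definition msr B : R := fine (mu B).

Lemma msrE B : measurable B -> mu B = (msr B)%:E.
Proof. by move=> mB; rewrite fineK// fin_num_measure. Qed.

Lemma msr_ge0 B : 0 <= msr B. Proof. exact: fine_ge0. Qed.

Lemma msrT : msr setT = 1. Proof. by rewrite /msr probability_setT. Qed.

Lemma msr0 : msr set0 = 0. Proof. by rewrite /msr measure0. Qed.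

Lemma msrU B C : measurable B -> measurable C -> B `&` C = set0 ->
  msr (B `|` C) = msr B + msr C.
Proof. by move=> mB mC BC; rewrite /msr measureU// fineD// fin_num_measure. Qed.

Lemma le_msr B C : measurable B -> measurable C -> B `<=` C -> msr B <= msr C.
Proof.
by move=> mB mC BC; rewrite -lee_fin -!msrE//; apply: le_measure; rewrite ?inE.
Qed.

Lemma msrU_le B C : measurable B -> measurable C -> msr (B `|` C) <= msr B + msr C.
Proof.
move=> mB mC; rewrite -lee_fin EFinD -!msrE//; last exact: measurableU.
exact: measureU2.
Qed.

Definition mfin I (g : T -> I) : Prop := forall i, measurable (g @^-1` [set i]).

Definition law I (g : T -> I) (i : I) : R := msr (g @^-1` [set i]).

Lemma law_ge0 I (g : T -> I) i : 0 <= law g i. Proof. exact: msr_ge0. Qed.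

Lemma mfin_preimage I (g : T -> I) (P : pred I) : mfin g ->
  measurable (g @^-1` [set i | P i]) /\
  msr (g @^-1` [set i | P i]) = \sum_(i | P i) law g i.
Proof.
move=> mg.
have key (s : seq I) : uniq s -> measurable [set x | (g x \in s) && P (g x)] /\
    msr [set x | (g x \in s) && P (g x)] = \sum_(i <- s | P i) law g i.
  elim: s => [|i s IH] /= => [_|/andP[i_s /IH[ms es]]].
    rewrite big_nil (_ : [set x | _] = set0); last by apply/seteqP; split.
    by rewrite msr0.
  have [Pi|nPi] := boolP (P i); last first.
    rewrite big_cons (negPf nPi) (_ : [set x | _] = [set x | (g x \in s) && P (g x)])//.
    apply/seteqP; split=> x /=; rewrite inE; last by case/andP=> -> ->; rewrite orbT.
    by have [->|//] := eqVneq (g x) i; rewrite (negPf nPi) andbF.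
  rewrite big_cons Pi (_ : [set x | _] = g @^-1` [set i] `|` [set x | (g x \in s) && P (g x)]).
    split; first exact: measurableU.
    rewrite msrU ?es//; apply/seteqP; split=> // x /= [->].
    by rewrite (negPf i_s).
  apply/seteqP; split=> x /=; rewrite inE.
    by have [->|_] := eqVneq (g x) i; [left|right].
  by case=> [->|/andP[-> ->]]; rewrite ?eqxx ?Pi ?orbT.
have [m e] := key (index_enum I) (index_enum_uniq I).
rewrite (_ : _ @^-1` _ = [set x | (g x \in index_enum I) && P (g x)])//.
by apply/seteqP; split=> x /=; rewrite mem_index_enum.
Qed.

Lemma law_comp I J (g : T -> I) (phi : I -> J) j : mfin g ->
  law (phi \o g) j = \sum_(i | phi i == j) law g i.
Proof.
move=> mg; have [_ <-] := mfin_preimage (fun i => phi i == j) mg.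
by congr (msr _); apply/seteqP; split=> x /= /eqP.
Qed.

Lemma sum_law I (g : T -> I) : mfin g -> \sum_i law g i = 1.
Proof.
move=> mg; have [_ <-] := mfin_preimage predT mg.
by rewrite -msrT; congr (msr _); apply/seteqP.
Qed.

Lemma sum_law_comp I J (g : T -> I) (phi : I -> J) (F : J -> R) : mfin g ->
  \sum_j law (phi \o g) j * F j = \sum_i law g i * F (phi i).
Proof.
move=> mg; rewrite [RHS](partition_big phi predT)//=; apply: eq_bigr => j _.
by rewrite law_comp// mulr_suml; apply: eq_bigr => i /eqP ->.
Qed.

Lemma mfin_pair I J (g : T -> I) (g' : T -> J) : mfin g -> mfin g' ->
  mfin (fun x => (g x, g' x)).
Proof.
move=> mg mg' [i j].
rewrite (_ : _ @^-1` _ = (g @^-1` [set i]) `&` (g' @^-1` [set j])); first exact: measurableI.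
by apply/seteqP; split=> x /= => [[]|[-> ->]].
Qed.

Lemma mfin_ffun I n (g : 'I_n -> T -> I) : (forall k, mfin (g k)) ->
  mfin (fun x => [ffun k => g k x]).
Proof.
move=> mg a.
rewrite (_ : _ @^-1` _ = \bigcap_(k : 'I_n) (g k @^-1` [set a k])).
  apply: fin_bigcap_measurable => // k _; exact: mg.
apply/seteqP; split=> x /= => [<- k _|xa] /=; first by rewrite ffunE.
by apply/ffunP => k; rewrite ffunE; exact: xa.
Qed.

Lemma law_preserves I (g : T -> I) (f : T -> T) n : preserves mu f ->
  (forall B, measurable B -> measurable (f @^-1` B)) -> mfin g ->
  mfin (g \o iter n f) /\ law (g \o iter n f) = law g.
Proof.
move=> pf mf mg; elim: n => [//|n [mn en]].
have E : g \o iter n.+1 f = (g \o iter n f) \o f by apply/funext => x; rewrite /= -iterSr.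
split=> [i|]; first by rewrite E comp_preimage; exact: mf.
apply/funext => i; rewrite E -en /law /msr; congr fine.
by rewrite -[RHS]pf.
Qed.

End FiniteMaps.

(** * Partition entropy against word counts *)

Section EntropyUpperBound.
Variables (R : realType) (A : finType) (X : subshift A) (mu : probability (borel X) R).
Local Notation T := (@points_shift A X : borel X -> borel X).
Hypothesis muT : preserves mu T.

Lemma measurable_shift (B : set (borel X)) : measurable B -> measurable (T @^-1` B).
Proof.
have [cT _ _] := shift_automorphism X.
have mT : measurable_fun setT (T : borel X -> borel X).
  apply: (@measurability _ _ (borel X) (borel X) _ _ (@open (points X))) => // _ [V oV <-].
  rewrite setTI; apply: sub_sigma_algebra; apply: open_comp => // x _; exact: cT.
by move=> mB; rewrite -[X in measurable X]setTI; exact: mT.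
Qed.

Lemma mfin_windowed (I : finType) (q : points X -> I) w :
  (forall x y, agree w (crd x) (crd y) -> q x = q y) -> @mfin _ (borel X) I q.
Proof.
move=> qw i; apply: measurable_cylindrical; exists w => x y xy /= <-.
by rewrite (qw _ _ xy).
Qed.

Lemma mfin_word k n : @mfin _ (borel X) _ (fun x : points X => tword (crd x) k n).
Proof.
apply: (@mfin_windowed _ _ (absz k + n)) => x y xy; apply: val_inj => /=.
by apply: eq_word => j jn; apply: xy; lia.
Qed.

Lemma law_shift (I : finType) (g : borel X -> I) n : mfin g ->
  mfin (g \o iter n T) /\ law mu (g \o iter n T) = law mu g.
Proof. by apply: law_preserves => //; exact: measurable_shift. Qed.

Lemma mfin_itinerary (I : finType) (q : borel X -> I) n : mfin q ->
  mfin (itinerary T q n).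
Proof.
move=> mq; have := @mfin_ffun _ _ I n (fun k => q \o iter k T); apply => k.
exact: (law_shift k mq).1.
Qed.

Lemma partition_entropy_law (I : finType) (q : borel X -> I) :
  partition_entropy mu q = - \sum_i law mu q i * ln (law mu q i).
Proof. by []. Qed.

Section Kernel.
Variables (I : finType) (q q' : borel X -> I) (w n : nat) (K : I -> I -> R).
Hypothesis mq : mfin q.
Hypothesis q'w : forall x y : points X, agree w (crd x) (crd y) -> q' x = q' y.
Hypothesis K0 : forall b c, 0 < K b c.
Hypothesis K1 : forall c, \sum_b K b c <= 1.

(* Gibbs' inequality against the distribution that picks a word of length
   n + 2w uniformly and then perturbs its q'-itinerary letter by letter by K. *)
Lemma partition_entropy_le : partition_entropy mu (itinerary T q n) <=
  ln #|Lang X (n + w.*2)|%:R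
  - n%:R * \sum_p law mu (fun x => (q x, q' x)) p * ln (K p.1 p.2).
Proof.
have mq' : mfin q' by exact: mfin_windowed q'w.
have /choice[x xP] := @point_of_word A X (- w%:Z) (n + w.*2).
pose c (W : (n + w.*2).-tuple A) (i : 'I_n) := q' (iter i T (x W)).
pose L : R := #|Lang X (n + w.*2)|%:R.
have L0 : 0 < L by rewrite ltr0n card_Lang_gt0.
pose word' (z : borel X) := tword (crd z) (- w%:Z) (n + w.*2).
have cW z i : c (word' z) i = q' (iter i T z).
  apply: q'w => j jw; rewrite !iter_points_shift.
  have zx : word (crd z) (- w%:Z) (n + w.*2) = word (crd (x (word' z))) (- w%:Z) (n + w.*2).
    exact: (xP (word' z) (tword_Lang _ _ _)).
  have := word_inj zx (k := absz (j + i%:Z + w%:Z)%R).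
  have -> : - w%:Z + (absz (j + i%:Z + w%:Z)%R)%:Z = j + i%:Z by lia.
  by move=> ->//; have := ltn_ord i; lia.
pose prodK (a : {ffun 'I_n -> I}) W := \prod_(i < n) K (a i) (c W i).
have prodK0 a W : 0 < prodK a W by apply: prodr_gt0.
pose Q a := L^-1 * \sum_(W in Lang X (n + w.*2)) prodK a W.
have Q0 a : 0 < Q a.
  rewrite mulr_gt0 ?invr_gt0//.
  have /card_gt0P[W WL] := card_Lang_gt0 X (n + w.*2).
  by rewrite (bigD1 W)//= ltr_wpDr ?prodK0// sumr_ge0// => V _; exact: ltW.
(* Expectations are taken under the joint law of the [q]-itinerary and the word actually seen, which
   determines the [q']-itinerary by [cW]. *)
pose g z := (itinerary T q n z, word' z).
have mit := mfin_itinerary (n := n) mq.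
have mg : mfin g by apply: mfin_pair => //; exact: mfin_word.
rewrite partition_entropy_law; apply: le_trans (gibbs_inequality (q := Q) _ _ _ _) _.
- by move=> a; exact: law_ge0.
- by move=> a; exact: ltW.
- by [].
- rewrite sum_law// -mulr_sumr ler_pdivrMl// mulr1 exchange_big/=.
  rewrite /L -sum1_card natr_sum; apply: ler_sum => W _.
  (* Summed over all itineraries, the product factors into column sums of [K], each at most 1; hence
     [Q] is a subprobability. *)
  rewrite -(bigA_distr_bigA (fun i b => K b (c W i))).
  by apply: prodr_ile1 => i _; rewrite K1 sumr_ge0// => b _; exact: ltW.
have -> : \sum_a law mu (itinerary T q n) a * ln (Q a) =
    \sum_p law mu g p * ln (Q p.1) by
  exact: (sum_law_comp mu (fun p => p.1) (fun a => ln (Q a)) mg).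
have -> : ln #|Lang X (n + w.*2)|%:R = \sum_p law mu g p * ln L.
  by rewrite -mulr_suml sum_law// mul1r.
have -> : n%:R * (\sum_p law mu (fun x => (q x, q' x)) p * ln (K p.1 p.2)) =
    \sum_p law mu g p * \sum_(i < n) ln (K (p.1 i) (c p.2 i)).
  under [RHS]eq_bigr do rewrite mulr_sumr.
  rewrite exchange_big /=.
  (* By invariance of [mu] every time [i] contributes the same expectation, whence the factor
     [n]. *)
  have Ei (i : 'I_n) : \sum_p law mu g p * ln (K (p.1 i) (c p.2 i)) =
      \sum_p law mu (fun x => (q x, q' x)) p * ln (K p.1 p.2).
    have <- := (law_shift i (mfin_pair mq mq')).2.
    have -> : (fun x => (q x, q' x)) \o iter i T =
        (fun p : {ffun 'I_n -> I} * (n + w.*2).-tuple A => (p.1 i, c p.2 i)) \o g.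
      by apply/funext => z; rewrite /= cW ffunE.
    by rewrite (sum_law_comp mu _ (fun p => ln (K p.1 p.2)) mg).
  by under [RHS]eq_bigr do rewrite Ei; rewrite sumr_const card_ord mulr_natl.
rewrite -sumrN -sumrB; apply: ler_sum => -[a W] _ /=.
have := law_ge0 mu g (a, W); rewrite le_eqVlt => /predU1P[<-|gaW].
  by rewrite !mul0r oppr0 addr0.
have WL : W \in Lang X (n + w.*2).
  apply: contraT => WL; move: gaW; rewrite /law (_ : _ @^-1` _ = set0) ?msr0 ?ltxx//.
  by apply/seteqP; split=> // z /= [_ zW]; move: WL; rewrite -zW tword_Lang.
rewrite -mulrBr -mulrN ler_pM2l// -opprB lerN2.
have -> : \sum_(i < n) ln (K (a i) (c W i)) = ln (prodK a W).
  rewrite /prodK; have : (forall i, 0 < K (a i) (c W i)) by [].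
  elim: (index_enum _) => [|i s IH] pos; rewrite ?big_nil ?ln1// !big_cons.
  by rewrite lnM ?posrE ?IH// prodr_gt0.
(* Keeping only the summand of the word actually seen costs [ln L] and leaves a product, whose
   logarithm is additive over time. *)
have QW : prodK a W / L <= Q a.
  rewrite mulrC ler_pM2l ?invr_gt0//.
  by rewrite (bigD1 W)//= lerDl sumr_ge0// => V _; exact: ltW.
by rewrite -ln_div ?posrE// ler_ln ?posrE// divr_gt0.
Qed.

End Kernel.

Lemma bigsetU_msr_le (I : Type) (s : seq I) (B : I -> set (borel X)) :
  (forall i, measurable (B i)) ->
  msr mu (\big[setU/set0]_(i <- s) B i) <= \sum_(i <- s) msr mu (B i).
Proof.
move=> mB; elim: s => [|i s IH]; first by rewrite !big_nil msr0.
rewrite !big_cons; apply: le_trans (msrU_le _ _ _) _ => //; last by rewrite lerD2l.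
by apply: bigsetU_measurable.
Qed.

(** Each atom is approximated by a cylindrical set, and [q'] picks an index whose set contains the
    point, with default [ord0]. Where [q] and [q'] differ, the point lies in the symmetric
    difference for [q x] or for [q' x]. *)
Lemma windowed_approx k (q : borel X -> 'I_k) (e : R) : 0 < e -> mfin q ->
  exists w (q' : borel X -> 'I_k),
    (forall x y : points X, agree w (crd x) (crd y) -> q' x = q' y) /\
    \sum_(p | p.1 != p.2) law mu (fun x => (q x, q' x)) p <= e.
Proof.
case: k q => [|k] q e0 mq; first by case: (q point).
have ek : 0 < e / k.+1%:R by rewrite divr_gt0.
have /choice[C CP] : forall i, exists C, cylindrical C /\
    (mu ((q @^-1` [set i]) `+` C) <= (e / k.+1%:R)%:E)%E.
  by move=> i; have [C cC Ce] := cylindrical_approx mu (mq i) ek; exists C.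
have /choice[wi wP] : forall i, exists w, windowed w (C i) by move=> i; exact: (CP i).1.
pose w := \max_i wi i.
have Cw i x y : agree w (crd x) (crd y) -> C i x = C i y.
  move=> xy; have xy' : agree (wi i) (crd x) (crd y).
    by apply: agree_le xy; exact: leq_bigmax.
  by apply/propext; split; apply: (wP i); [|exact: agree_sym].
pose q' (x : borel X) := odflt ord0 [pick i | `[< C i x >]].
have q'w (x y : points X) : agree w (crd x) (crd y) -> q' x = q' y.
  by move=> xy; rewrite /q'; congr odflt; apply: eq_pick => i; rewrite (Cw i x y).
exists w, q'; split=> //.
have mqq' := mfin_pair mq (mfin_windowed q'w).
have [mD <-] := mfin_preimage mu (fun p => p.1 != p.2) mqq'.
have mE i : measurable ((q @^-1` [set i]) `+` C i).
  have mC := measurable_cylindrical (CP i).1.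
  by apply: measurableU; apply: measurableD => //; exact: mq.
apply: (@le_trans _ _ (msr mu (\big[setU/set0]_(i : 'I_k.+1) ((q @^-1` [set i]) `+` C i)))).
  apply: le_msr => //; first by apply: bigsetU_measurable.
  move=> x /= qx.
  have [i xi] : exists i, ((q @^-1` [set i]) `+` C i) x.
    have [Cq|nCq] := pselect (C (q x) x); last by exists (q x); left.
    exists (q' x); right; split; last by move=> /= qq; rewrite qq eqxx in qx.
    rewrite /q'; case: pickP => [i /asboolP//|/(_ (q x))].
    by move/asboolPn.
  by rewrite (bigD1 i)//=; left.
apply: le_trans (bigsetU_msr_le _ mE) _.
apply: (@le_trans _ _ (\sum_(i < k.+1) e / k.+1%:R)).
  by apply: ler_sum => i _; rewrite -lee_fin -msrE//; exact: (CP i).2.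
by rewrite sumr_const card_ord -[leLHS]mulr_natr divfK.
Qed.

Lemma measure_entropy_le (h : R) : 0 <= h ->
  (fun n => ln #|Lang X n|%:R / n%:R) @ \oo --> h -> (measure_entropy mu T <= h%:E)%E.
Proof.
move=> h0 hlim; apply: ge_ereal_sup => _ [k [q [mq ->]]]; rewrite lee_fin.
rewrite /entropy_of_partition; set s := fun n => _.
have [cs|ncs] := pselect (cvg (s @ \oo)); last by rewrite dvgP.
apply/ler_addgt0Pr => e e0.
have k0 : (0 < k)%N by case: k q {mq s cs} => // q; case: (q point).
pose e' := e / 2; have e'0 : 0 < e' by rewrite divr_gt0.
pose d := 1 - expR (- e').
have d0 : 0 < d by rewrite subr_gt0 expR_lt1 oppr_lt0.
have d1 : d < 1 by rewrite gtrBl expR_gt0.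
have kR : 0 < k%:R :> R by rewrite ltr0n.
have dk1 : d / k%:R <= 1.
  by rewrite ler_pdivrMr// mul1r (le_trans (ltW d1))// ler1n.
pose lam := - ln (d / k%:R).
have lam0 : 0 <= lam by rewrite oppr_ge0 ln_le0.
(* The kernel favours keeping the letter and spreads the remaining mass [d] evenly. Agreement then
   costs exactly [e'] and disagreement [lam], which depends only on [e] and [k]. *)
pose K (b c : 'I_k) := if b == c then expR (- e') else d / k%:R.
have K0 b c : 0 < K b c by rewrite /K; case: ifP => _; rewrite ?expR_gt0 ?divr_gt0.
have K1 c : \sum_b K b c <= 1.
  rewrite (bigD1 c)//= {1}/K eqxx.
  apply: (@le_trans _ _ (expR (- e') + \sum_(b : 'I_k) d / k%:R)).
    rewrite lerD2l [leRHS](bigD1 c)//= -[leLHS]add0r; apply: lerD.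
      by rewrite divr_ge0// ltW.
    by apply: ler_sum => b /negPf bc; rewrite /K bc.
  rewrite sumr_const card_ord -[X in _ + X]mulr_natr divfK ?gt_eqF// /d; lra.
(* The error [e' / (1 + lam)] is chosen after [lam], so that disagreements cost at most [e'] in
   total. *)
have [w [q' [q'w qq']]] := windowed_approx (divr_gt0 e'0 (ltr_pwDl ltr01 lam0)) mq.
have mqq' : mfin (fun x => (q x, q' x)) := mfin_pair mq (mfin_windowed q'w).
have kappa : - \sum_p law mu (fun x => (q x, q' x)) p * ln (K p.1 p.2) <= e.
  rewrite -sumrN (bigID (fun p => p.1 == p.2))/= (splitr e); apply: lerD.
    apply: (@le_trans _ _ (\sum_p law mu (fun x => (q x, q' x)) p * e')); last first.
      by rewrite -mulr_suml sum_law// mul1r.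
    rewrite [leRHS](bigID (fun p => p.1 == p.2))/= -[leLHS]addr0 lerD//; last first.
      by apply: sumr_ge0 => p _; rewrite mulr_ge0 ?law_ge0// ltW.
    by apply: ler_sum => p /eqP pp; rewrite /K pp eqxx expRK mulrN opprK.
  apply: (@le_trans _ _ (\sum_(p | p.1 != p.2) law mu (fun x => (q x, q' x)) p * (1 + lam))).
    apply: ler_sum => p /negPf pp; rewrite /K pp -mulrN -/lam ler_wpM2l ?law_ge0//.
    by rewrite lerDr.
  rewrite -mulr_suml -/e'; apply: le_trans (ler_wpM2r _ qq') _; first by rewrite addr_ge0.
  by rewrite divfK// gt_eqF// ltr_pwDl.
pose g n := ln #|Lang X n|%:R / n%:R + ln #|Lang X w.*2|%:R / n%:R + e : R.
have glim : g @ \oo --> h + 0 + e.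
  apply: cvgD; last exact: cvg_cst.
  apply: cvgD => //; rewrite -(mulr0 (ln #|Lang X w.*2|%:R)).
  by apply: cvgM; [exact: cvg_cst|rewrite -cvg_shiftS; exact: cvg_harmonic].
have <- : limn g = h + e by rewrite (cvg_lim _ glim) ?addr0//; exact: norm_hausdorff.
apply: ler_lim => //; first exact: cvgP glim.
near=> n; have n0 : 0 < n%:R :> R by rewrite ltr0n; near: n; exact: nbhs_infty_gt.
rewrite /s /g ler_pdivrMr// !mulrDl !divfK ?gt_eqF//.
apply: le_trans (partition_entropy_le n mq q'w K0 K1) _.
by apply: lerD; [exact: ln_LangD|rewrite -mulrN mulrC ler_wpM2r// ltW].
Unshelve. all: by end_near. Qed.

End EntropyUpperBound.

(** * Lower bound and the characteristic measure *)

Lemma block_entropy_mono (R : realType) (I : finType) (p : seq I -> R) m n :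
  stationary p -> (m <= n)%N -> block_entropy p m <= block_entropy p n.
Proof.
move=> sp /subnKC <-; set l := (n - m)%N; have [p0 _ _ _] := sp.
rewrite /block_entropy lerN2 (sum_tupleD (fun w => p w * ln (p w))).
apply: ler_sum => u _; rewrite -(sum_suffix sp l u) mulr_suml.
apply: ler_sum => v _; have := p0 (u ++ v); rewrite le_eqVlt => /predU1P[<-|puv].
  by rewrite !mul0r.
rewrite ler_pM2l// sum_suffix// ler_ln ?posrE//; first exact: le_prefix.
exact: lt_le_trans puv (le_prefix sp u v).
Qed.

Section Itineraries.
Variables (Omega : Type) (I : finType) (f : Omega -> Omega) (q : Omega -> I).

(** Itineraries as lists, the form that [stationary] requires. *)
Definition visits n (x : Omega) : seq I := [seq q (iter i f x) | i <- iota 0 n].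

Lemma visitsS n x : visits n.+1 x = q x :: visits n (f x).
Proof.
rewrite /visits /=; congr (_ :: _); rewrite -[1%N]addn0 iotaDl -map_comp.
by apply: eq_map => i /=; rewrite -iterSr.
Qed.

Lemma visits_rcons n x : visits n.+1 x = rcons (visits n x) (q (iter n f x)).
Proof. by rewrite /visits -addn1 iotaD map_cat cats1. Qed.

Definition visit_set (w : seq I) : set Omega := [set x | visits (size w) x = w].

Variables (R : realType) (M : set (set Omega)) (P : set Omega -> R).

Lemma visit_set_closed : M setT -> (forall B, M B -> M (f @^-1` B)) ->
  (forall B a, M B -> M (B `&` q @^-1` [set a])) -> forall w, M (visit_set w).
Proof.
move=> MT Mf Mq; elim=> [|a w IH].
  by rewrite (_ : visit_set _ = setT)//; apply/seteqP; split.
rewrite (_ : visit_set _ = f @^-1` visit_set w `&` q @^-1` [set a]); first exact/Mq/Mf.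
apply/seteqP; split=> x; rewrite /visit_set /= visitsS; first by case.
by case=> -> ->.
Qed.

(** The abstract [M] and [P] serve two cases: an invariant measure on measurable sets and the
    uniform weight on all sets of loops. *)
Lemma stationary_visits : M setT -> (forall B, M B -> M (f @^-1` B)) ->
  (forall B a, M B -> M (B `&` q @^-1` [set a])) ->
  (forall B, 0 <= P B) -> P setT = 1 -> (forall B, M B -> P (f @^-1` B) = P B) ->
  (forall B n, M B -> \sum_a P (B `&` (q \o iter n f) @^-1` [set a]) = P B) ->
  stationary (fun w => P (visit_set w)).
Proof.
move=> MT Mf Mq P0 PT Pf Pq; have Mw := visit_set_closed MT Mf Mq.
split=> [w||w|w]; first exact: P0.
- by rewrite -PT; congr P; apply/seteqP; split.
- rewrite -Pf// -(Pq _ 0%N); last exact: Mf.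
  apply: eq_bigr => a _; congr P.
  apply/seteqP; split=> x; rewrite /visit_set /= visitsS; first by case.
  by case=> -> ->.
- rewrite -[RHS](Pq _ (size w))//; apply: eq_bigr => a _; congr P.
  apply/seteqP; split=> x; rewrite /visit_set /= size_rcons visits_rcons.
    by move/eqP; rewrite eqseq_rcons => /andP[/eqP ? /eqP].
  by case=> -> ->.
Qed.

End Itineraries.

Section MeasureProcess.
Context d (T : measurableType d) (R : realType) (mu : probability T R).
Variables (I : finType) (f : T -> T) (q : T -> I).
Hypothesis mf : forall B, measurable B -> measurable (f @^-1` B).
Hypothesis muf : preserves mu f.
Hypothesis mq : mfin q.

Lemma stationary_measure : stationary (fun w => msr mu (visit_set f q w)).
Proof.
apply: (stationary_visits (M := measurable)) => //.
- by move=> B a mB; apply: measurableI => //; exact: mq.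
- by move=> B; exact: msr_ge0.
- exact: msrT.
- by move=> B mB; rewrite /msr; congr fine; exact: muf.
move=> B n mB; have [mqn _] := law_preserves n muf mf mq.
(* Recording membership in [B] as a Boolean turns the sum over letters into a sum over values of one
   finite-valued map. *)
pose g x := (q (iter n f x), `[< B x >]).
have mg : mfin g.
  apply: mfin_pair => // -[].
    by rewrite (_ : _ @^-1` _ = B)//; apply/seteqP; split=> x /= /asboolP.
  rewrite (_ : _ @^-1` _ = ~` B); first exact: measurableC.
  by apply/seteqP; split=> x /= => [/negbT/asboolPn|/asboolPn/negbTE].
have [_] := mfin_preimage mu (fun p => p.2) mg.
rewrite (_ : _ @^-1` _ = B); last by apply/seteqP; split=> x /= /asboolP.
move=> ->; rewrite (eq_bigr (fun i => law mu g (i.1, i.2))) => [|[]//].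
rewrite -(pair_big_dep predT (fun _ b => b) (fun a b => law mu g (a, b)))/=.
apply: eq_bigr => a _; rewrite (big_pred1 true); last by case.
congr (msr _ _); apply/seteqP; split=> x /=.
  by move=> [Bx <-]; rewrite /g asboolT.
by move=> [<- /asboolP].
Qed.

Lemma partition_entropy_visits n :
  partition_entropy mu (itinerary f q n) = block_entropy (fun w => msr mu (visit_set f q w)) n.
Proof.
rewrite /partition_entropy /block_entropy; congr (- _).
rewrite (reindex (fun w : n.-tuple I => [ffun i => tnth w i])) /=; last first.
  exists (fun a : {ffun 'I_n -> I} => [tuple a i | i < n]) => [w _|a _].
    by apply: eq_from_tnth => i; rewrite tnth_mktuple ffunE.
  by apply/ffunP => i; rewrite ffunE tnth_mktuple.
apply: eq_bigr => w _; rewrite -/(msr mu _).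
suff -> : itinerary f q n @^-1` [set [ffun i => tnth w i]] = visit_set f q w by [].
apply/seteqP; split=> x; rewrite /visit_set /= size_tuple => xw.
  apply: (@eq_from_nth _ (q x)); first by rewrite size_map size_iota size_tuple.
  move=> i; rewrite size_map size_iota => ilt.
  rewrite (nth_map 0%N) ?size_iota// nth_iota//.
  have := congr1 (fun a : {ffun 'I_n -> I} => a (Ordinal ilt)) xw.
  by rewrite !ffunE (tnth_nth (q x)).
apply/ffunP => i; rewrite !ffunE (tnth_nth (q x)) -xw.
by rewrite (nth_map 0%N) ?size_iota// nth_iota.
Qed.

End MeasureProcess.

(* The loops of length N.+1 are a finite dynamical system under rotation; its
   uniform measure has block entropy ln #|S| at length N.+1. *)
Section LoopProcess.
Variables (R : realType) (A : finType) (X : subshift A) (m N : nat).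
Hypothesis S_gt0 : (0 < #|window_loops X m N|)%N.
Local Notation S := (window_loops X m N).

Definition rotate (f : {ffun 'I_N.+1 -> A}) : {ffun 'I_N.+1 -> A} :=
  [ffun k : 'I_N.+1 => slide 1 (per f) k%:Z].

Lemma per_rotate f : per (rotate f) = slide 1 (per f).
Proof.
by apply: per_ffun => i; rewrite /slide addrAC per_period.
Qed.

Lemma per_iter_rotate n f : per (iter n rotate f) = slide n%:Z (per f).
Proof.
elim: n => [|n IH]; first by rewrite slide0.
by rewrite iterS per_rotate IH slideD; congr (slide _ _); lia.
Qed.

(** Letters are ranked to match partition labels, which [measure_entropy] takes in ordinals. *)
Definition loop_letter (f : {ffun 'I_N.+1 -> A}) : 'I_#|A| := enum_rank (per f 0).

Definition loop_freq (B : set {ffun 'I_N.+1 -> A}) : R :=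
  #|[set f in S | `[< B f >]]%SET|%:R / #|S|%:R.

Let S0 : 0 < #|S|%:R :> R. Proof. by rewrite ltr0n. Qed.

Lemma stationary_loops : stationary (fun w => loop_freq (visit_set rotate loop_letter w)).
Proof.
apply: (stationary_visits (M := setT)) => //.
- by move=> B; rewrite divr_ge0.
- rewrite /loop_freq (_ : [set f in S | _]%SET = S) ?divff ?gt_eqF//.
  by apply/setP => f; rewrite inE asboolT// andbT.
- move=> B _; rewrite /loop_freq; congr (_%:R / _).
  apply: (card_preim_inj (fun f => `[< B f >])).
    move=> f g _ _ fg; apply: per_inj => i.
    have := congr1 (fun h => per h (i - 1)) fg.
    by rewrite /= !per_rotate /slide subrK.
  move=> f /loopsP lf; apply/loopsP; rewrite per_rotate => i.
  have := lf (i + 1); congr (language _ _); apply: eq_word => k _.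
  by rewrite /slide; congr (per f _); ring.
- move=> B n _; rewrite /loop_freq -mulr_suml; congr (_ / _).
  rewrite -natr_sum; congr (_%:R).
  rewrite -[RHS]sum1_card (partition_big (fun f => loop_letter (iter n rotate f)) predT)//=.
  apply: eq_bigr => a _; rewrite -[LHS]sum1_card; apply: eq_bigl => f.
  rewrite !inE -andbA; congr (_ && _).
  apply/asboolP/andP => [[Bf <-]|[/asboolP Bf /eqP fa]] //.
  by split; [exact/asboolP|exact/eqP].
Qed.

Lemma visits_loop n f : visits rotate loop_letter n f = [seq enum_rank a | a <- word (per f) 0 n].
Proof.
rewrite /visits /word -map_comp; apply: eq_map => i /=.
by rewrite /loop_letter per_iter_rotate /slide add0r.
Qed.

Lemma block_entropy_loops :
  block_entropy (fun w => loop_freq (visit_set rotate loop_letter w)) N.+1 = ln #|S|%:R.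
Proof.
rewrite /block_entropy -[RHS]mul1r -[X in X * ln _](sum_blocks stationary_loops N.+1).
rewrite mulr_suml -sumrN.
apply: eq_bigr => w _.
set B := visit_set _ _ _.
(* A word of length [N.+1] covers a full period and determines the loop, so every word has weight 0
   or [1 / #|S|]. *)
have : (#|[set f in S | `[< B f >]]%SET| <= 1)%N.
  apply/card_le1_eqP => f g; rewrite !inE => /andP[_ /asboolP Bf] /andP[_ /asboolP Bg].
  move: Bf Bg; rewrite /B /visit_set /= size_tuple !visits_loop => <-.
  move=> /(inj_map enum_rank_inj)/word_inj fg.
  apply/ffunP => k; have := fg k (ltn_ord k).
  by rewrite !add0r !per_ord.
rewrite /loop_freq; case: #|_| => [|[|//]] _; first by rewrite !mul0r oppr0.
by rewrite !mul1r lnV ?posrE// mulrN opprK.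
Qed.

End LoopProcess.

Lemma clopen_cylindrical (A : finType) (X : subshift A) (C : set (points X)) :
  open C -> open (~` C) -> cylindrical C.
Proof.
move=> oC oD.
have [] := @uniform_window A X (fun m x => forall y, agree m (crd x) (crd y) -> C x -> C y).
- by move=> m n x mn xC y /(agree_le mn)/xC.
- move=> y; have [Cy|nCy] := pselect (C y).
    have [m mC] := open_points_agree oC Cy; exists m => x yx z xz _.
    by apply: mC; exact: agree_trans yx xz.
  have [m mC] := open_points_agree oD nCy; exists m => x yx z xz Cx.
  by case: (mC x yx).
- by move=> m mC; exists m => x y; exact: mC.
Qed.

Lemma cvg_sumr (R : realType) (I K : Type) (F : set_system K) (r : seq I)
  (u : K -> I -> R) (l : I -> R) : Filter F -> (forall i, u k i @[k --> F] --> l i) ->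
  \sum_(i <- r) u k i @[k --> F] --> \sum_(i <- r) l i.
Proof.
move=> FF ul; elim: r => [|i r IH].
  rewrite big_nil (_ : (fun k => _) = (fun=> 0)); first exact: cvg_cst.
  by apply/funext => k; rewrite big_nil.
rewrite big_cons (_ : (fun k => _) = (fun k => u k i + \sum_(j <- r) u k j)).
  by apply: cvgD => //; exact: ul.
by apply/funext => k; rewrite big_cons.
Qed.

(** A cluster point in the compact segment is a limit, because an ultrafilter contains each set or
    its complement. *)
Lemma ultra_bounded_cvg (R : realType) (U : set_system nat) (u : nat -> R) :
  UltraFilter U -> (forall k, 0 <= u k <= 1) -> cvg (u @ U).
Proof.
move=> UU u01.
have [|l [_ lU]] := @segment_compact R 0 1 (u @ U) _.
  have U01 : U (u @^-1` `[0, 1]) by apply: filterE => k; rewrite /= in_itv/= u01.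
  exact: U01.
apply/cvg_ex; exists l => V lV.
have [//|UV] := in_ultra_setVsetC (u @^-1` V) UU.
have UV' : (u @ U) (~` V) by [].
by have [x []] := lU _ _ UV' lV.
Qed.

(** * The limit measure and its entropy *)

Section CharacteristicMeasure.
Variables (R : realType) (A : finType) (X : subshift A).
Local Notation T := (@points_shift A X : borel X -> borel X).

Definition letter (x : borel X) : 'I_#|A| := enum_rank (crd x 0).

Lemma visits_shift n x : visits T letter n x = [seq enum_rank a | a <- word (crd x) 0 n].
Proof.
rewrite /visits /word -map_comp; apply: eq_map => i /=.
by rewrite /letter iter_points_shift.
Qed.

Lemma windowed_visit_set w : windowed (size w) (visit_set T letter w : set (points X)).
Proof.
move=> x y xy; rewrite /visit_set /= !visits_shift.
have -> // : word (crd y) 0 (size w) = word (crd x) 0 (size w).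
by apply: eq_word => k kn; rewrite xy//; lia.
Qed.

Lemma mfin_letter : mfin letter.
Proof. by apply: (@mfin_windowed _ _ _ _ 0) => x y xy; rewrite /letter xy. Qed.

Lemma empirical_visit_set m N w : (size w <= m)%N ->
  empirical R m N (visit_set T letter w : set (points X)) =
  loop_freq R X m (visit_set (@rotate A N) (@loop_letter A N) w).
Proof.
move=> wm; rewrite /empirical /loop_freq; congr (_%:R / _).
congr #|pred_of_set _|; apply/setP => f; rewrite !inE; apply: andb_id2l => lf.
have /loopsP/locally_inP/(_ 0)[x] : f \in window_loops X m N by rewrite inE.
rewrite slide0 => /retractP fx.
apply: asbool_equiv_eq; rewrite /visit_set /= visits_shift visits_loop.
have -> // : word (crd (retract X m (per f))) 0 (size w) = word (per f) 0 (size w).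
by apply: eq_word => k kn; rewrite fx//; lia.
Qed.

Lemma empirical_ge0 m N (C : set (points X)) : 0 <= empirical R m N C.
Proof. by rewrite divr_ge0. Qed.

Lemma empirical_le1 m N (C : set (points X)) : empirical R m N C <= 1.
Proof.
have [S0|S0] := posnP #|window_loops X m N|; first by rewrite /empirical S0 invr0 mulr0.
rewrite ler_pdivrMr ?ltr0n// mul1r ler_nat; apply/subset_leq_card/fintype.subsetP => f.
by rewrite inE => /andP[].
Qed.

Lemma empiricalT m N : (0 < #|window_loops X m N|)%N -> empirical R m N (setT : set (points X)) = 1.
Proof.
move=> S0; rewrite /empirical (_ : [set f in _ | _]%SET = window_loops X m N).
  by rewrite divff// pnatr_eq0 -lt0n.
by apply/setP => f; rewrite inE asboolT// andbT.
Qed.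

Lemma empiricalU m N (C D : set (points X)) : C `&` D = set0 ->
  empirical R m N (C `|` D) = empirical R m N C + empirical R m N D.
Proof.
move=> CD; rewrite /empirical -mulrDl -natrD; congr (_%:R / _).
set S := window_loops X m N.
rewrite -cardsUI [X in (_ + X)%N](_ : _ = 0%N); last first.
  apply/eqP; rewrite cards_eq0; apply/eqP/setP => f; rewrite !inE.
  apply/negP => /andP[/andP[_ /asboolP Cf] /andP[_ /asboolP Df]].
  by have : (C `&` D) (retract X m (per f)) by []; rewrite CD.
rewrite addn0; congr #|pred_of_set _|; apply/setP => f; rewrite !inE -andb_orr.
by congr (_ && _); rewrite -asbool_or.
Qed.

(** Rounding [N.+1] up to a multiple of [n] uses monotonicity; subadditivity then transfers entropy
    from the growing length [N.+1] to the fixed length [n], at which the limit can be taken. *)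
Lemma loop_entropy_le m N n : (0 < #|window_loops X m N|)%N -> (0 < n)%N ->
  n%:R * ln #|window_loops X m N|%:R <=
  (N.+1 + n)%:R * block_entropy
    (fun w => loop_freq R X m (visit_set (@rotate A N) (@loop_letter A N) w)) n.
Proof.
move=> S0 n0; have sp := stationary_loops R S0; set p := fun w => _ in sp *.
have Nq : (N.+1 <= (N.+1 %/ n).+1 * n)%N by rewrite ltnW// ltn_ceil.
rewrite -(block_entropy_loops R S0) -/p.
apply: (@le_trans _ _ (n%:R * ((N.+1 %/ n).+1%:R * block_entropy p n))).
  rewrite ler_wpM2l//; apply: le_trans (block_entropy_mono sp Nq) _.
  exact: block_entropy_mul.
rewrite mulrA -natrM ler_wpM2r ?block_entropy_ge0// ler_nat mulnC mulSn addnC leq_add2r.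
exact: leq_trunc_div.
Qed.

Lemma characteristic_measure (h : R) : 0 <= h ->
  (forall n, h * n%:R <= ln #|Lang X n|%:R) -> language_stable R X ->
  exists mu : probability (borel X) R,
    (forall psi, automorphism psi -> preserves mu psi) /\
    (h%:E <= measure_entropy mu T)%E.
Proof.
move=> h0 hL hX.
have /choice[m mP] : forall k, exists m, (k <= m)%N /\ gap X k m.
  by move=> k; have [m] := language_stable_gap hX k; exists m.
(* The loss [harmonic k] tends to 0, and [k <= N k] makes the rounding error at any fixed block
   length negligible. *)
have /choice[N NP] : forall k, exists N, [/\ (k <= N)%N, (0 < #|window_loops X (m k) N|)%N &
    (h - harmonic k) * N.+1%:R <= ln #|window_loops X (m k) N|%:R].
  by move=> k; apply: (loops_growth (m k + m k) h0 _ hL k); rewrite invr_gt0.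
have S0 k : (0 < #|window_loops X (m k) (N k)|)%N by case: (NP k).
(* A single ultrafilter makes the empirical values of all sets converge together, so finite
   additivity passes to the limit. *)
have [U [UU leU]] := ultraFilterLemma eventually_filter.
pose emp k := @empirical R A X (m k) (N k).
pose p (C : set (points X)) : R := lim (emp k C @[k --> U]).
have pcvg C : emp k C @[k --> U] --> p C.
  by apply: ultra_bounded_cvg => k; rewrite empirical_ge0 empirical_le1.
have nearU (P : set nat) : (\forall k \near \oo, P k) -> U P by exact: leU.
have [|||mu muE] := @probability_extension R A X p.
- move=> C; apply: limr_ge; first exact: cvgP (pcvg C).
  by apply: nearW => k; exact: empirical_ge0.
- apply: cvg_lim; first exact: norm_hausdorff.
  by apply: cvg_near_cst; apply: nearW => k; exact: empiricalT.
- move=> C D _ _ CD; apply: cvg_lim; first exact: norm_hausdorff.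
  rewrite (_ : (fun k => _) = (fun k => emp k C + emp k D)).
    exact: cvgD (pcvg C) (pcvg D).
  by apply/funext => k; exact: empiricalU.
have muaut psi : automorphism psi -> preserves mu psi.
  move=> apsi; have [cpsi _ _] := apsi; apply: preserves_cylindrical => // C cC.
  have cC' : cylindrical (psi @^-1` C).
    apply: clopen_cylindrical.
      by apply: open_comp; [move=> x _; exact: cpsi|exact: cylindrical_open].
    rewrite -[~` _]/(psi @^-1` (~` C)); apply: open_comp; first by move=> x _; exact: cpsi.
    exact/cylindrical_open/cylindricalC.
  rewrite !muE//; congr EFin; apply: cvg_lim; first exact: norm_hausdorff.
  (* Once [k] exceeds [w + k0], the radius [m k] is large enough and a gap of size [k] contains one
     of size [k0], so the empirical values of [C] and its preimage agree exactly. *)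
  have [k0 empE] := empirical_invariant R apsi; have [w wC] := cC.
  apply: cvg_trans (pcvg C); apply: near_eq_cvg; apply: nearU.
  exists (w + k0)%N => // k /= wk; have [km gm] := mP k.
  rewrite /emp (empE w C wC)//; first exact: leq_trans km.
  move=> y ly; apply: (locally_in_le (n := (m k + k)%N)); last exact: gm.
  by rewrite leq_add2l; lia.
exists mu; split=> //.
have muT : preserves mu T by apply: muaut; exact: shift_automorphism.
have sP := stationary_measure (@measurable_shift A X) muT mfin_letter.
set P := fun w => _ in sP.
have Pcvg w : (fun k => loop_freq R X (m k)
    (visit_set (@rotate A (N k)) (@loop_letter A (N k)) w)) @ U --> P w.
  have -> : P w = p (visit_set T letter w).
    by rewrite /P /msr muE//; exists (size w); exact: windowed_visit_set.
  apply: cvg_trans (pcvg _); apply: near_eq_cvg; apply: nearU.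
  exists (size w) => // k /= wk; rewrite /emp empirical_visit_set//.
  by apply: leq_trans wk _; case: (mP k).
have Hcvg n : (fun k => block_entropy (fun w => loop_freq R X (m k)
    (visit_set (@rotate A (N k)) (@loop_letter A (N k)) w)) n) @ U --> block_entropy P n.
  apply: cvgN; apply: cvg_sumr => w; apply: cvg_xlnx (Pcvg w) => k.
  by rewrite divr_ge0.
have harmU : harmonic k @[k --> U] --> (0 : R).
  by move=> V /cvg_harmonic; exact: leU.
(* For fixed block length the inequality of [loop_entropy_le], divided by the period, passes to the
   limit: only finitely many words occur, and the ratio of block length to period is at most the
   block length times [harmonic k]. *)
have hP n : n%:R * h <= block_entropy P n.
  case: n => [|n]; first by rewrite mul0r block_entropy_ge0.
  have l1 : n.+1%:R * (h - harmonic k) @[k --> U] --> n.+1%:R * (h - 0).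
    by apply: cvgM; [exact: cvg_cst|apply: cvgB => //; exact: cvg_cst].
  have l2 : (1 + n.+1%:R * harmonic k) * block_entropy (fun w => loop_freq R X (m k)
    (visit_set (@rotate A (N k)) (@loop_letter A (N k)) w)) n.+1 @[k --> U] -->
      (1 + n.+1%:R * 0) * block_entropy P n.+1.
    apply: cvgM => //; apply: cvgD; first exact: cvg_cst.
    by apply: cvgM => //; exact: cvg_cst.
  rewrite subr0 in l1; rewrite mulr0 addr0 mul1r in l2.
  rewrite -(cvg_lim (@norm_hausdorff _ _) l1) -(cvg_lim (@norm_hausdorff _ _) l2).
  apply: ler_lim; [exact: cvgP l1|exact: cvgP l2|apply: nearW => k].
  have [kN _ hN] := NP k; have N0 : 0 < (N k).+1%:R :> R by [].
  rewrite -(ler_pM2r N0) -mulrA.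
  apply: le_trans (ler_wpM2l _ hN) _ => //.
  apply: le_trans (loop_entropy_le (S0 k) (ltn0Sn n)) _.
  rewrite mulrAC ler_wpM2r//; first exact: (block_entropy_ge0 (stationary_loops R (S0 k))).
  rewrite mulrDl mul1r natrD lerD2l -mulrA -[leLHS]mulr1 ler_wpM2l//.
  by rewrite mulrC ler_pdivlMr// mul1r ler_nat.
have [l Pl _] := fekete (block_entropy_ge0 sP) (block_entropyD sP).
apply: ereal_sup_ge; exists l%:E.
  exists #|A|, letter; split; first exact: mfin_letter.
  congr EFin; symmetry; apply: cvg_lim; first exact: norm_hausdorff.
  rewrite (_ : (fun n => _) = (fun n => block_entropy P n / n%:R))//.
  by apply/funext => n; rewrite partition_entropy_visits.
rewrite lee_fin -(cvg_lim (@norm_hausdorff _ _) Pl).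
apply: limr_ge; first exact: cvgP Pl.
by exists 1%N => // n /= n0; rewrite ler_pdivlMr ?ltr0n// mulrC.
Qed.

End CharacteristicMeasure.

Theorem corollary4p2 (R : realType) (A : finType) (X : subshift A)
    (hX : language_stable R X) :
  exists mu : probability (borel X) R,
    [/\ preserves mu (@points_shift A X),
        forall psi : points X -> points X, automorphism psi -> preserves mu psi
      & measure_entropy mu (@points_shift A X)
        = topological_entropy R (@points_shift A X)].
Proof.
have [h [h0 hlim hL]] := language_entropy R X.
have [mu [muaut hmu]] := characteristic_measure h0 hL hX.
have muT := muaut _ (shift_automorphism X).
exists mu; split=> //; rewrite (topological_entropyE h0 hlim).
by apply/eqP; rewrite eq_le hmu measure_entropy_le.
Qed.
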